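(* Let $G$ be a subgroup of $(M_n(\mathbb{C}),+)$ and assume that $M \mapsto \exp(M)$ is a group homomorphism from $(G,+)$ to $(\mathrm{GL}_n(\mathbb{C}),\times)$. Then $AB = BA$ for all $A, B \in G$.
   Context: $\exp$ denotes the matrix exponential. *)

(* Defs.v *)
(* complex numbers as pairs of Stdlib reals, n x n complex
   matrices as functions nat -> nat -> C (only indices < n are meaningful). *)
From Stdlib Require Import Reals ClassicalEpsilon Factorial.
Open Scope R_scope.

Definition C : Type := (R * R)%type.
Definition C0 : C := (0, 0).
Definition C1 : C := (1, 0).
Definition Cadd (z w : C) : C := (fst z + fst w, snd z + snd w).
Definition Copp (z : C) : C := (- fst z, - snd z).
Definition Cmul (z w : C) : C :=
  (fst z * fst w - snd z * snd w, fst z * snd w + snd z * fst w).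
Definition Crscale (r : R) (z : C) : C := (r * fst z, r * snd z).

Fixpoint Csum (m : nat) (f : nat -> C) : C :=
  match m with
  | O => C0
  | S k => Cadd (Csum k f) (f k)
  end.

Definition Mat : Type := nat -> nat -> C.

Definition Mzero : Mat := fun _ _ => C0.
Definition Mid : Mat := fun i j => if Nat.eqb i j then C1 else C0.
Definition Madd (A B : Mat) : Mat := fun i j => Cadd (A i j) (B i j).
Definition Mopp (A : Mat) : Mat := fun i j => Copp (A i j).
Definition Mmul (n : nat) (A B : Mat) : Mat :=
  fun i j => Csum n (fun l => Cmul (A i l) (B l j)).
Definition Mrscale (r : R) (A : Mat) : Mat := fun i j => Crscale r (A i j).

Definition Meq (n : nat) (A B : Mat) : Prop :=
  forall i j, (i < n)%nat -> (j < n)%nat -> A i j = B i j.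

Fixpoint Mpow (n : nat) (A : Mat) (k : nat) : Mat :=
  match k with
  | O => Mid
  | S k' => Mmul n (Mpow n A k') A
  end.

Fixpoint exp_partial (n : nat) (A : Mat) (N : nat) : Mat :=
  match N with
  | O => Mid
  | S N' => Madd (exp_partial n A N')
                 (Mrscale (/ INR (fact (S N'))) (Mpow n A (S N')))
  end.

(* limit of a real sequence (chosen by classical choice; the series
   defining exp always converges, so this is the genuine limit) *)
Definition Rlim (u : nat -> R) : R := epsilon (inhabits 0) (fun l => Un_cv u l).

Definition Mexp (n : nat) (A : Mat) : Mat :=
  fun i j => (Rlim (fun N => fst (exp_partial n A N i j)),
              Rlim (fun N => snd (exp_partial n A N i j))).

Definition is_add_subgroup (n : nat) (G : Mat -> Prop) : Prop :=
  G Mzero /\ (forall A B, G A -> G B -> G (Madd A B)) /\ (forall A, G A -> G (Mopp A)).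

(* Main.v *)
Require Import Defs.
From Stdlib Require Import Reals Classical ClassicalEpsilon.
From Stdlib Require Lra.
From mathcomp Require Import all_boot all_order all_algebra.
From mathcomp Require Import ring lra zify.
From mathcomp Require Import Rstruct complex.
Set Implicit Arguments. Unset Strict Implicit. Unset Printing Implicit Defensive.
Import Order.TTheory GRing.Theory Num.Theory.
Local Open Scope ring_scope.

(** Write [M = D_M + N_M] for the Jordan-Chevalley decomposition. The
    semisimple and unipotent parts of [e^M] are [e^(D_M)] and [e^(N_M)], and a
    nilpotent matrix is a polynomial in its exponential; as the [e^M], [M] in
    [G], commute, [M |-> D_M] and [M |-> N_M] are additive on [G] and the [N_M]
    commute with each other.

    For diagonalizable [A], [B] in [G], replace them by multiples so that no
    ratio of eigenvalues of [e^B] is a nontrivial root of unity. Then [e^A] and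
    [e^B] are in the bicommutant of [e^(A + k B)] for all large [k], hence
    commute with [A] and [B]. Subtracting logarithms of [e^A] and [e^B] leaves
    [X], [Y] with [exp (k X + l Y) = 1] for all integers [k], [l]; up to the
    factor [2 pi i], all [k X + l Y] are diagonalizable with integral
    eigenvalues.

    Eigenvalues of [k X + Y] stay at bounded distance from [k] times those of
    [X], so finitely many integral linear forms [w] satisfy
    [prod_w (z X + Y - w(z)) = 0] identically in [z]. The spectral projections
    of [z X + Y] are rational in [z]; their possible poles are rational numbers,
    and these are removable because [z X + Y] is diagonalizable there. By degree
    the projections are constant, so [X] and [Y] commute (the argument of
    Motzkin-Taussky and Kato). Finally [D_A + k D_B] commutes with [A + k B], and
    a generic [k] separates the joint eigenvalues, so that everything commutes. *)

(** * Diagonalizable and nilpotent matrices *)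

Section Diagonalizable.
Variables (K : fieldType) (n : nat).
Implicit Types A B P Z : 'M[K]_n.+1.

Definition nilpotent_mx A := exists m, A ^+ m = 0.

(** With [P^-1] on the left, the rows of [P] are left eigenvectors of [conj_mx P A] when [A] is
    diagonal. *)
Definition conj_mx P A := P^-1 * A * P.

Lemma conj_mxM P A B : P \is a GRing.unit ->
  conj_mx P A * conj_mx P B = conj_mx P (A * B).
Proof. by move=> uP; rewrite /conj_mx !mulrA mulrK. Qed.

Lemma conj_mxD P A B : conj_mx P A + conj_mx P B = conj_mx P (A + B).
Proof. by rewrite /conj_mx mulrDr mulrDl. Qed.

Lemma conj_mxN P A : - conj_mx P A = conj_mx P (- A).
Proof. by rewrite /conj_mx mulrN mulNr. Qed.

Lemma conj_mxZ P a A : a *: conj_mx P A = conj_mx P (a *: A).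
Proof. by rewrite /conj_mx -scalerAr scalerAl. Qed.

Lemma conj_mx1 P : P \is a GRing.unit -> conj_mx P 1 = 1.
Proof. by move=> uP; rewrite /conj_mx mulr1 mulVr. Qed.

Lemma conj_mxK P A : P \is a GRing.unit -> P * conj_mx P A * P^-1 = A.
Proof. by move=> uP; rewrite /conj_mx !mulrA mulrK // mulrV // mul1r. Qed.

Lemma conj_mxVK P A : P \is a GRing.unit -> conj_mx P (P * A * P^-1) = A.
Proof. by move=> uP; rewrite /conj_mx !mulrA mulVr // mul1r mulrVK. Qed.

Lemma conj_mx_inj P : P \is a GRing.unit -> injective (conj_mx P).
Proof. by move=> uP A B e; rewrite -(conj_mxK A uP) e conj_mxK. Qed.

Lemma conj_mxX P A m : P \is a GRing.unit -> conj_mx P A ^+ m = conj_mx P (A ^+ m).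
Proof.
move=> uP; elim: m => [|m IH]; first by rewrite !expr0 conj_mx1.
by rewrite !exprS IH conj_mxM.
Qed.

Lemma diagonalizable_conj P d :
  P \is a GRing.unit -> diagonalizable (conj_mx P (diag_mx d)).
Proof.
move=> uP; exists P => //; apply/(diagonalizable_forLR uP); exists d.
by rewrite mxpoly.conjVmx.
Qed.

Lemma diagonalizable_ex A : diagonalizable A ->
  exists P d, P \is a GRing.unit /\ A = conj_mx P (diag_mx d).
Proof.
move=> [P uP /(diagonalizable_forLR uP) [d ->]]; exists P, d; split=> //.
by rewrite mxpoly.conjVmx.
Qed.

Lemma codiagonalizable_ex A B : GRing.comm A B ->
  diagonalizable A -> diagonalizable B ->
  exists P a b, [/\ P \is a GRing.unit, A = conj_mx P (diag_mx a)
                  & B = conj_mx P (diag_mx b)].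
Proof.
move=> cAB dA dB.
have [|P uP] := (codiagonalizableP [:: A; B]).1.
  split=> [M N|M]; rewrite !inE; last by case/orP=> /eqP->.
  by case/orP=> /eqP-> /orP[] /eqP-> //; rewrite /comm_mx cAB.
case/and3P => /(diagonalizable_forLR uP)[a ->] /(diagonalizable_forLR uP)[b ->] _.
by exists P, a, b; split; rewrite ?mxpoly.conjVmx.
Qed.

Lemma diag_mxM (a b : 'rV[K]_n.+1) :
  diag_mx a * diag_mx b = diag_mx (\row_i (a 0 i * b 0 i)).
Proof.
apply/matrixP=> i j; rewrite -mulmxE mul_diag_mx !mxE.
by case: eqP => [->|]; rewrite ?mulr1n // mulr0n mulr0.
Qed.

Lemma diag_mxX (a : 'rV[K]_n.+1) m : diag_mx a ^+ m = diag_mx (\row_i (a 0 i ^+ m)).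
Proof.
elim: m => [|m IH].
  rewrite expr0 -[1]/(1%:M) -diag_const_mx; congr diag_mx.
  by apply/rowP=> i; rewrite !mxE expr0.
by rewrite exprS IH diag_mxM; congr diag_mx; apply/rowP=> i; rewrite !mxE exprS.
Qed.

Lemma diagonalizableD A B : GRing.comm A B ->
  diagonalizable A -> diagonalizable B -> diagonalizable (A + B).
Proof.
move=> cAB dA dB; have [P [a [b [uP -> ->]]]] := codiagonalizable_ex cAB dA dB.
by rewrite conj_mxD -raddfD; apply: diagonalizable_conj.
Qed.

Lemma diagonalizableM A B : GRing.comm A B ->
  diagonalizable A -> diagonalizable B -> diagonalizable (A * B).
Proof.
move=> cAB dA dB; have [P [a [b [uP -> ->]]]] := codiagonalizable_ex cAB dA dB.
by rewrite conj_mxM // diag_mxM; apply: diagonalizable_conj.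
Qed.

Lemma diagonalizableZ c A : diagonalizable A -> diagonalizable (c *: A).
Proof.
case/diagonalizable_ex=> P [a [uP ->]].
by rewrite conj_mxZ -linearZ; apply: diagonalizable_conj.
Qed.

Lemma diagonalizableN A : diagonalizable A -> diagonalizable (- A).
Proof. by rewrite -scaleN1r; apply: diagonalizableZ. Qed.

Lemma diagonalizable_horner A p : diagonalizable A -> diagonalizable (horner_mx A p).
Proof.
move=> dA; elim/poly_ind: p => [|p c IH]; first by rewrite rmorph0; apply: diagonalizable0.
rewrite rmorphD rmorphM /= horner_mx_X horner_mx_C.
apply: diagonalizableD (diagonalizable_scalar _); first exact: comm_mx_scalar.
by apply: diagonalizableM => //; apply: comm_horner_mx.
Qed.

Lemma diagonalizable_nilpotent0 A : diagonalizable A -> nilpotent_mx A -> A = 0.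
Proof.
case/diagonalizable_ex=> P [a [uP ->]] [m].
rewrite conj_mxX // diag_mxX => H.
have {}H : diag_mx (\row_i a 0 i ^+ m) = 0.
  by apply: (conj_mx_inj uP); rewrite H /conj_mx mulr0 mul0r.
suff -> : a = 0 by rewrite raddf0 /conj_mx mulr0 mul0r.
apply/rowP=> i; rewrite mxE; move/matrixP/(_ i i): H; rewrite !mxE eqxx mulr1n.
by move/eqP; rewrite expf_eq0 => /andP[_ /eqP].
Qed.

Lemma nilpotent_mxD A B : GRing.comm A B ->
  nilpotent_mx A -> nilpotent_mx B -> nilpotent_mx (A + B).
Proof.
move=> cAB [p Ap] [q Bq]; exists (p + q)%N; rewrite exprDn_comm //.
apply: big1 => i _; have [le|lt] := leqP i q.
  have -> : (p + q - i)%N = (p + (q - i))%N by lia.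
  by rewrite exprD Ap !mul0r mul0rn.
have -> : (i : nat) = (q + (i - q))%N by lia.
by rewrite (exprD B q) Bq mul0r mulr0 mul0rn.
Qed.

Lemma nilpotent_mxM A B : GRing.comm A B -> nilpotent_mx A -> nilpotent_mx (A * B).
Proof. by move=> cAB [p Ap]; exists p; rewrite exprMn_comm // Ap mul0r. Qed.

Lemma nilpotent_mxN A : nilpotent_mx A -> nilpotent_mx (- A).
Proof. by move=> [p Ap]; exists p; rewrite exprNn Ap mulr0. Qed.

(* In the basis [P], an entry [(i, j)] of [Z] with [a 0 i != a 0 j] must vanish. *)
Lemma comm_diag_transfer (a b : 'rV[K]_n.+1) P Z : P \is a GRing.unit ->
  (forall i j, a 0 i = a 0 j -> b 0 i = b 0 j) ->
  GRing.comm Z (conj_mx P (diag_mx a)) -> GRing.comm Z (conj_mx P (diag_mx b)).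
Proof.
move=> uP ab; rewrite -(conj_mxVK Z uP); move: (P * Z * P^-1) => W.
rewrite /GRing.comm !conj_mxM // => /(conj_mx_inj uP) H; congr conj_mx.
apply/matrixP=> i j; move/matrixP/(_ i j): H.
rewrite -!mulmxE !mul_diag_mx !mul_mx_diag !mxE.
have [/ab->|ne] := eqVneq (a 0 i) (a 0 j); first by move=> _; rewrite mulrC.
move/eqP; rewrite mulrC -subr_eq0 -mulrBl mulf_eq0 subr_eq0 eq_sym (negPf ne) /=.
by move/eqP->; rewrite mulr0 mul0r.
Qed.

End Diagonalizable.

(** * The Jordan-Chevalley decomposition *)

Section Dunford.
Variables (K : closedFieldType) (n : nat).
Implicit Types A D E : 'M[K]_n.+1.

Lemma poly_crt_const (s : seq K) (m : nat) : uniq s ->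
  exists d : {poly K}, {in s, forall x, ('X - x%:P) ^+ m %| d - x%:P}.
Proof.
elim: s => [|r s IH] /=; first by exists 0.
case/andP=> rs /IH[d Hd]; set Q := ('X - r%:P) ^+ m.
pose P := \prod_(x <- s) ('X - x%:P) ^+ m.
have /Bezout_eq1_coprimepP[[u v] /= uv] : coprimep P Q.
  rewrite coprimep_sym /P big_seq.
  apply: (big_ind (fun p => coprimep Q p)) => [|a b ca cb|x xs].
  - exact: coprimep1.
  - by rewrite coprimepMr ca.
  - apply/coprimep_expl/coprimep_expr/coprimep_XsubC2; rewrite subr_eq0.
    by apply: contraNneq rs => <-.
(* As [u * P + v * Q = 1], the factor [u * P] is [1] modulo [Q] and [0] modulo the earlier powers,
   so only the residue at [r] changes. *)
exists (d + (r%:P - d) * (u * P)) => x; rewrite inE => /orP[/eqP->|xs].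
  have -> : d + (r%:P - d) * (u * P) - r%:P = (d - r%:P) * v * Q.
    by have -> : u * P = 1 - v * Q; [rewrite -uv addrK | ring].
  exact: dvdp_mull.
rewrite addrAC dvdp_add ?Hd // !dvdp_mull // /P (big_rem x) //=.
exact: dvdp_mulr.
Qed.

(** Cayley-Hamilton is used twice: the characteristic polynomial divides the product of the [d - x]
    over the distinct roots [x], so [d(A)] is diagonalizable, and it divides [('X - d) ^+ size rs],
    so [A - d(A)] is nilpotent. *)
Lemma dunford_exists A : exists D, [/\ diagonalizable D, nilpotent_mx (A - D)
  & exists p, D = horner_mx A p].
Proof.
have [rs Hrs] := closed_field_poly_normal (char_poly A).
rewrite (monicP (char_poly_monic A)) scale1r in Hrs.
have [d Hd] := poly_crt_const (size rs) (undup_uniq rs).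
have CH p : char_poly A %| p -> horner_mx A p = 0.
  by case/dvdpP=> q ->; rewrite rmorphM /= [horner_mx A (char_poly A)]Cayley_Hamilton mulr0.
exists (horner_mx A d); split; last by exists d.
- apply/diagonalizableP; exists (undup rs); first exact: undup_uniq.
  apply: mxminpoly_min; rewrite rmorph_prod /=.
  have -> : \prod_(i <- undup rs) horner_mx (horner_mx A d) ('X - i%:P) =
            horner_mx A (\prod_(i <- undup rs) (d - i%:P)).
    rewrite rmorph_prod; apply: eq_bigr => i _ /=.
    by rewrite !rmorphB /= horner_mx_X !horner_mx_C.
  apply: CH; rewrite Hrs -prodr_undup_exp_count.
  elim: (undup rs) Hd => [|x s IH] Hd; first by rewrite !big_nil dvdpp.
  rewrite !big_cons dvdp_mul //; last first.
    by apply: IH => y ys; apply: Hd; rewrite inE ys orbT.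
  apply: dvdp_trans (Hd x (mem_head _ _)); apply: dvdp_exp2l; exact: count_size.
- exists (size rs).
  have -> : A - horner_mx A d = horner_mx A ('X - d) by rewrite rmorphB /= horner_mx_X.
  rewrite -rmorphXn /=; apply: CH; rewrite Hrs.
  have {Hrs} : {in rs, forall x, 'X - x%:P %| 'X - d}.
    move=> x xrs; have -> : 'X - d = ('X - x%:P) - (d - x%:P) by ring.
    apply: dvdp_sub => //; apply: dvdp_trans (Hd x _); last by rewrite mem_undup.
    by case: (rs) xrs => //= ? ? _; rewrite exprS dvdp_mulr.
  elim: (rs) => [|x s IH] H; first by rewrite big_nil expr0.
  rewrite big_cons exprS dvdp_mul ?H ?mem_head //.
  by apply: IH => y ys; apply: H; rewrite inE ys orbT.
Qed.

Lemma dunford_unique A D E :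
  diagonalizable D -> nilpotent_mx (A - D) -> GRing.comm A D ->
  diagonalizable E -> nilpotent_mx (A - E) -> GRing.comm A E -> D = E.
Proof.
(* [D] and [E] are not known to commute, so both are compared with [S], which commutes with each as
   a polynomial in [F]; the difference is diagonalizable and nilpotent. *)
have key F : exists S, forall D, diagonalizable D -> nilpotent_mx (F - D) ->
    GRing.comm F D -> D = S.
  have [S [dS nS [p Sp]]] := dunford_exists F; exists S => D0 dD nD cD.
  have cDS : GRing.comm D0 S by rewrite Sp; apply: comm_mx_horner; apply/esym.
  apply/eqP; rewrite -subr_eq0; apply/eqP/diagonalizable_nilpotent0.
    by apply: diagonalizableD (diagonalizableN _) => //; apply: commrN.
  have -> : D0 - S = (F - S) + - (F - D0) by apply/esym; rewrite opprB addrC addrA subrK.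
  have cFS : GRing.comm F S by rewrite Sp; apply: comm_mx_horner.
  apply: nilpotent_mxD (nilpotent_mxN _) => //; apply/commrN/commrB.
    exact/commr_sym/commrB.
  by apply/commr_sym/commrB => //; apply/commr_sym.
by have [S HS] := key A => *; rewrite (HS D) // (HS E).
Qed.

Lemma dunford_bicomm A D Z : diagonalizable D -> nilpotent_mx (A - D) -> GRing.comm A D ->
  GRing.comm Z A -> GRing.comm Z D.
Proof.
move=> dD nD cD cZ; have [S [dS nS [p Sp]]] := dunford_exists A.
rewrite (@dunford_unique A D S) //; last by rewrite Sp; apply: comm_mx_horner.
by rewrite Sp; apply: comm_mx_horner.
Qed.

End Dunford.

(** * Pencils with integral eigenvalues *)

Section PencilPoly.
Variables (K : numFieldType) (n : nat).
Implicit Types M Q : 'M[{poly K}]_n.+1.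

Lemma polymx_eval0_dvd (z : K) M : map_mx (horner_eval z) M = 0 ->
  exists Q, M = ('X - z%:P) *: Q.
Proof.
move=> H; exists (\matrix_(i, j) (M i j %/ ('X - z%:P))).
apply/matrixP=> i j; rewrite !mxE mulrC divpK // dvdp_XsubCl.
by move/matrixP/(_ i j): H; rewrite !mxE /horner_eval => /eqP.
Qed.

Lemma polymx_eq0 M : (forall k : nat, map_mx (horner_eval k%:R) M = 0) -> M = 0.
Proof.
move=> H; apply/matrixP=> i j; rewrite mxE; apply/eqP/negPn/negP=> nz.
suff : (size [seq (k%:R : K) | k <- iota 0 (size (M i j))] < size (M i j))%N.
  by rewrite size_map size_iota ltnn.
apply: max_poly_roots => //.
- apply/allP=> _ /mapP[k _ ->]; move/matrixP/(_ i j): (H k).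
  by rewrite !mxE /horner_eval => /eqP.
- by rewrite map_inj_uniq ?iota_uniq // => a b /eqP; rewrite eqr_nat => /eqP.
Qed.

Lemma horner_mx_eigen (R : comNzRingType) (T N : 'M[R]_n.+1) (a : R) p :
  T * N = a *: N -> horner_mx T p * N = p.[a] *: N.
Proof.
move=> TN; elim/poly_ind: p => [|p c IH]; first by rewrite rmorph0 mul0r horner0 scale0r.
rewrite rmorphD rmorphM /= horner_mx_X horner_mx_C mulrDl -mulrA TN -scalerAr IH.
by rewrite scalerA hornerMXaddC scalerDl mulrC -[_%:M * N]/(_%:M *m N) mul_scalar_mx.
Qed.

Lemma size_prod_linear_mx (I : Type) (s : seq I) (F : I -> 'M[{poly K}]_n.+1) :
  (forall k (i j : 'I_n.+1), (size (F k i j) <= 2)%N) ->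
  forall i j : 'I_n.+1, (size ((\prod_(k <- s) F k)%R i j) <= (size s).+1)%N.
Proof.
move=> sF; elim: s => [|k s IH] i j.
  by rewrite big_nil mxE; case: eqP => _; rewrite ?size_poly1 ?size_poly0.
rewrite big_cons mxE; apply: leq_trans (size_sum _ _ _) _; apply/bigmax_leqP=> l _.
apply: leq_trans (size_polyMleq _ _) _.
by have := sF k i l; have := IH l j; move=> /= *; lia.
Qed.

Lemma dvdp_prod_XsubC (s : seq K) (p : {poly K}) :
  (forall a, ('X - a%:P) ^+ count_mem a s %| p) -> \prod_(a <- s) ('X - a%:P) %| p.
Proof.
move=> H; rewrite -prodr_undup_exp_count.
elim: (undup s) (undup_uniq s) => [|a t IH] /=; first by rewrite big_nil dvd1p.
case/andP=> at_ ut; rewrite big_cons Gauss_dvdp ?H ?IH //.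
rewrite big_seq; apply: (big_ind (fun q => coprimep _ q)) => [|q r cq cr|x xt].
- exact: coprimep1.
- by rewrite coprimepMr cq.
- apply/coprimep_expl/coprimep_expr/coprimep_XsubC2; rewrite subr_eq0.
  by apply: contraNneq at_ => <-.
Qed.

End PencilPoly.

Section Pencil.
Variables (K : numFieldType) (n : nat) (X Y : 'M[K]_n.+1).

Definition pencil : 'M[{poly K}]_n.+1 := 'X *: map_mx polyC X + map_mx polyC Y.

(** The pair [(l, m)] encodes the linear form [l z + m], a candidate eigenvalue of [z X + Y]; the
    indeterminate ['X] is [z]. *)
Definition weight (w : int * int) : {poly K} := w.1%:~R *: 'X + (w.2%:~R)%:P.

Definition weight_factor (w : int * int) : {poly {poly K}} := 'X - (weight w)%:P.

Lemma eval_pencil z : map_mx (horner_eval z) pencil = z *: X + Y.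
Proof.
by apply/matrixP=> i j; rewrite !mxE /horner_eval hornerD hornerM hornerX !hornerC.
Qed.

Lemma eval_horner_pencil z p : map_mx (horner_eval z) (horner_mx pencil p) =
  horner_mx (z *: X + Y) (map_poly (horner_eval z) p).
Proof. by rewrite map_horner_mx eval_pencil. Qed.

Lemma eval_weight w z : (weight w).[z] = w.1%:~R * z + w.2%:~R.
Proof. by rewrite /weight hornerD hornerZ hornerX hornerC. Qed.

Lemma eval_weight_factor z w :
  map_poly (horner_eval z) (weight_factor w) = 'X - ((weight w).[z])%:P.
Proof. by rewrite /weight_factor rmorphB /= map_polyX map_polyC. Qed.

Variable S : seq (int * int).
Hypothesis ann : horner_mx pencil (\prod_(w <- S) weight_factor w) = 0.

(** For distinct weights, the numerator of the spectral projection at [weight w0]; the denominator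
    is the product of the other [weight w0 - weight w]. *)
Definition cofactor_mx w0 := horner_mx pencil (\prod_(w <- rem w0 S) weight_factor w).

Lemma pencil_cofactor w0 : w0 \in S -> pencil * cofactor_mx w0 = weight w0 *: cofactor_mx w0.
Proof.
move=> w0S; apply/eqP; rewrite -subr_eq0 -mul_scalar_mx mulmxE -mulrBl /cofactor_mx.
have -> : pencil - (weight w0)%:M = horner_mx pencil (weight_factor w0).
  by rewrite rmorphB /= horner_mx_X horner_mx_C.
by rewrite -rmorphM /=; move: ann; rewrite (big_rem w0) //= => ->.
Qed.

(* The pole of the spectral projection at [z] is removable because [z X + Y] is
   diagonalizable: with [g] the product of the factors not vanishing at [z], each
   [(pencil - w) g] with [w] meeting [w0] at [z] vanishes at [z]. *)
Lemma cofactor_local w0 z : w0 \in S -> diagonalizable (z *: X + Y) ->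
  exists Q, cofactor_mx w0 =
    ('X - z%:P) ^+ count (fun w => (weight w).[z] == (weight w0).[z]) (rem w0 S) *: Q.
Proof.
move=> w0S dT; set c := (weight w0).[z].
pose a w := (weight w).[z] == c; pose r := count a (rem w0 S).
rewrite -/(count a (rem w0 S)) -/r.
pose g := \prod_(w <- rem w0 S | ~~ a w) weight_factor w.
have E0 : \prod_(w <- rem w0 S) weight_factor w =
    \prod_(w <- rem w0 S | a w) weight_factor w * g by rewrite (bigID a).
(* A power of this matrix contains the annihilating product at [z], so it is nilpotent; being a
   polynomial in a diagonalizable matrix, it vanishes. *)
have g0 : horner_mx (z *: X + Y) (('X - c%:P) * map_poly (horner_eval z) g) = 0.
  apply: diagonalizable_nilpotent0; first exact: diagonalizable_horner.
  exists r.+1; rewrite -rmorphXn /= exprMn (exprS _ r) [X in _ * X]exprS.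
  rewrite mulrA rmorphM /=.
  suff -> : horner_mx (z *: X + Y) (('X - c%:P) * ('X - c%:P) ^+ r *
      map_poly (horner_eval z) g) = 0 by rewrite mul0r.
  have := eval_horner_pencil z (\prod_(w <- S) weight_factor w).
  rewrite ann map_mx0 (big_rem w0) //= E0 !rmorphM /= eval_weight_factor => ->.
  rewrite mulrA; congr (_ * horner_mx _ _ * _); rewrite rmorph_prod /= /r.
  elim: (rem w0 S) => [|w s IH] /=; first by rewrite big_nil.
  rewrite big_cons; case: ifP => [aw|_]; last by rewrite add0n.
  by rewrite add1n exprS IH eval_weight_factor (eqP aw).
have Eg w : a w -> exists Q, horner_mx pencil (weight_factor w * g) = ('X - z%:P) *: Q.
  move=> aw; apply: polymx_eval0_dvd; rewrite eval_horner_pencil rmorphM /=.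
  by rewrite eval_weight_factor (eqP aw).
have [Q1 HQ1] : exists Q, horner_mx pencil
    (\prod_(w <- rem w0 S | a w) weight_factor w * g ^+ r) = ('X - z%:P) ^+ r *: Q.
  rewrite /r; elim: (rem w0 S) => [|w s [Q IH]] /=.
    by exists 1; rewrite big_nil !expr0 mulr1 rmorph1 scale1r.
  rewrite big_cons; case: ifP => [aw|_]; last by exists Q; rewrite add0n.
  have [Q2 HQ2] := Eg w aw; exists (Q2 * Q); rewrite add1n !exprS mulrACA rmorphM /=.
  by rewrite HQ2 IH -scalerAl -scalerAr scalerA.
(* On the image of the cofactor the pencil acts as [weight w0], so [g ^+ r] acts as the scalar
   [g.[weight w0] ^+ r], which does not vanish at [z] and can be cancelled. *)
have gam : g.[weight w0] ^+ r *: cofactor_mx w0 = ('X - z%:P) ^+ r *: (Q1 * horner_mx pencil g).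
  rewrite scalerAl -HQ1 -rmorphM /= -mulrA [_ ^+ r * g]mulrC mulrA -E0 mulrC rmorphM /=.
  by rewrite (horner_mx_eigen _ (pencil_cofactor w0S)) horner_exp.
have ng : ~~ root g.[weight w0] z.
  rewrite /g; elim: (rem w0 S) => [|w s IH]; first by rewrite big_nil hornerC root1.
  rewrite big_cons; case: ifP => // aw; rewrite hornerM rootM negb_or IH andbT.
  by rewrite /weight_factor hornerXsubC rootE hornerD hornerN subr_eq0 eq_sym.
exists (\matrix_(i, j) (cofactor_mx w0 i j %/ ('X - z%:P) ^+ r)).
apply/matrixP=> i j; rewrite !mxE mulrC divpK //.
move/matrixP/(_ i j): gam; rewrite mxE [RHS]mxE => gam.
rewrite -(@Gauss_dvdpr _ _ (g.[weight w0] ^+ r)); first by rewrite gam dvdp_mulr.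
apply/coprimep_expl/coprimep_expr; rewrite coprimep_sym.
by rewrite coprimep_XsubC.
Qed.

Hypothesis inj1 : uniq (map fst S).
Hypothesis dXY : forall k l : int, diagonalizable (X *~ k + Y *~ l).

Let uS : uniq S. Proof. exact: map_uniq inj1. Qed.

(** All poles being removable, the cofactor is a scalar polynomial times a constant matrix [P] whose
    nonzero columns are joint eigenvectors of [X] and [Y]; the commutator kills them. *)
Lemma cofactor_comm w0 : w0 \in S ->
  map_mx polyC (X * Y - Y * X) * cofactor_mx w0 = 0.
Proof.
move=> w0S; set S' := rem w0 S.
have l0 w : w \in S' -> (w0.1 - w.1)%:~R != 0 :> K.
  rewrite mem_rem_uniq // !inE => /andP[ne wS]; rewrite intr_eq0 subr_eq0.
  apply: contra_neq ne => e.
  move: inj1 w0S wS e; elim: (S) => //= v s IH /andP[vs us].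
  rewrite !inE => /orP[/eqP->|a] /orP[/eqP->|b] e //; last exact: IH us a b e.
    by case/negP: vs; rewrite e; apply: map_f.
  by case/negP: vs; rewrite -e; apply: map_f.
(* The parameter at which the lines [w] and [w0] cross. It is rational, so [zr w *: X + Y] is
   proportional to an integral combination of [X] and [Y], diagonalizable by [dXY]. *)
pose zr (w : int * int) : K := - (w0.2 - w.2)%:~R / (w0.1 - w.1)%:~R.
have zrP w z : w \in S' -> ((weight w).[z] == (weight w0).[z]) = (zr w == z).
  move=> /l0 nz; rewrite !eval_weight /zr; move: nz; rewrite !intrB => nz.
  apply/eqP/eqP=> [e|<-]; last by field.
  apply: (mulIf nz); rewrite divfK //; apply/eqP; rewrite -subr_eq0; apply/eqP.
  by rewrite -(subrr (w.1%:~R * z + w.2%:~R)) {2}e; ring.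
pose q : {poly K} := \prod_(z <- map zr S') ('X - z%:P).
have [P HP] : exists P : 'M[K]_n.+1, cofactor_mx w0 = q *: map_mx polyC P.
  have dv i j : q %| cofactor_mx w0 i j.
    apply: dvdp_prod_XsubC => z.
    have [zin|/count_memPn->] := boolP (z \in map zr S'); last by rewrite expr0 dvd1p.
    have dT : diagonalizable (z *: X + Y).
      case/mapP: zin => w wS' ->; have nz := l0 w wS'.
      have -> : zr w *: X + Y = (w0.1 - w.1)%:~R^-1 *:
          (X *~ (- (w0.2 - w.2)) + Y *~ (w0.1 - w.1)).
        rewrite -!scaler_int scalerDr !scalerA mulVf // scale1r /zr mulrC.
        by rewrite mulrNz.
      exact: diagonalizableZ.
    have [Q ->] := cofactor_local w0S dT; rewrite mxE count_map.
    rewrite (@eq_in_count _ _ (fun w => (weight w).[z] == (weight w0).[z])); last first.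
      by move=> w wS' /=; rewrite zrP.
    exact: dvdp_mulr.
  (* The entries have degree at most [size S'], the degree of [q], so the quotients are
     constants. *)
  exists (\matrix_(i, j) (cofactor_mx w0 i j %/ q)`_0).
  apply/matrixP=> i j; rewrite !mxE -[LHS](divpK (dv i j)) mulrC; congr (_ * _).
  apply: size1_polyC; rewrite size_divp; last by rewrite monic_neq0 // monic_prod_XsubC.
  rewrite size_prod_XsubC size_map leq_subLR addn1 /= /cofactor_mx rmorph_prod /=.
  apply: leq_trans (size_prod_linear_mx _ _ i j) _ => // w a b.
  rewrite /weight_factor rmorphB /= horner_mx_X horner_mx_C !mxE.
  rewrite (leq_trans (size_polyD _ _)) // geq_max size_polyN.
  rewrite (leq_trans (size_polyD _ _)) ?geq_max; last first.
    by rewrite size_polyC (leq_trans (leq_b1 _)) // (leq_trans (size_polyMleq _ _)) // size_polyX size_polyC; case: eqP.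
  case: (a == b); rewrite ?mulr0n ?size_poly0 // mulr1n /weight.
  rewrite (leq_trans (size_polyD _ _)) // geq_max (leq_trans (size_scale_leq _ _)) ?size_polyX //.
  by rewrite size_polyC (leq_trans (leq_b1 _)).
have q0 : q != 0 by rewrite monic_neq0 // monic_prod_XsubC.
have eP : pencil * map_mx polyC P = weight w0 *: map_mx polyC P.
  have := pencil_cofactor w0S; rewrite HP -scalerAr scalerA mulrC -scalerA.
  move=> /matrixP H; apply/matrixP=> i j; move: (H i j); rewrite mxE [RHS]mxE.
  exact: (mulfI q0).
(* The eigenvalue equation is read at [z = 0] and [z = 1]. *)
have [XP YP] : X * P = w0.1%:~R *: P /\ Y * P = w0.2%:~R *: P.
  have E z : (z *: X + Y) * P = (w0.1%:~R * z + w0.2%:~R) *: P.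
    rewrite -eval_weight -eval_pencil; have /(congr1 (map_mx (horner_eval z))) := eP.
    have cP : map_mx (horner_eval z) (map_mx polyC P) = P.
      by apply/matrixP=> i j; rewrite !mxE /horner_eval hornerC.
    by rewrite -mulmxE map_mxM map_mxZ cP.
  have YP : Y * P = w0.2%:~R *: P by have := E 0; rewrite scale0r add0r mulr0 add0r.
  split=> //; have := E 1; rewrite scale1r mulr1 mulrDl scalerDl YP.
  exact: addIr.
rewrite HP -scalerAr -[_ * map_mx _ P]/(_ *m _) -map_mxM mulmxE mulrBl -!mulrA XP YP -!scalerAr XP YP.
by rewrite !scalerA mulrC subrr map_mx0 scaler0.
Qed.

(** Once the commutator kills [p * (pencil - a)] and [p * (pencil - b)], subtraction shows that it
    kills [p], because [a - b] is a nonzero scalar. Starting from the cofactors, all factors are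
    dropped in turn; [A] lists those already removed and [B] those kept. *)
Lemma pencil_comm : X * Y = Y * X.
Proof.
have key (A B : seq (int * int)) : perm_eq (A ++ B) S -> A != [::] ->
    map_mx polyC (X * Y - Y * X) * horner_mx pencil (\prod_(w <- B) weight_factor w) = 0.
  have [k] := ubnP (size A); elim: k A B => // k IH [|a [|b A]] B //= sz pS _.
    have aS : a \in S by rewrite -(perm_mem pS) mem_head.
    rewrite -(cofactor_comm aS) /cofactor_mx; congr (_ * horner_mx _ _).
    apply: perm_big; rewrite -(perm_cons a) (perm_trans pS) // perm_sym.
    by rewrite perm_sym perm_to_rem.
  have ab : weight a != weight b.
    have : a.1 != b.1.
      move: inj1; rewrite -(perm_uniq (perm_map fst pS)) /= inE.
      by case/andP; rewrite negb_or => /andP[].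
    apply: contra_neq => /(congr1 (fun p : {poly K} => p`_1)).
    rewrite /weight !coefD !coefZ !coefX !coefC !mulr1 !addr0.
    by move/eqP; rewrite eqr_int => /eqP.
  have p1 : perm_eq ((b :: A) ++ a :: B) S.
    by apply: perm_trans pS; apply/permP=> x; rewrite /= !count_cat /=; lia.
  have p2 : perm_eq ((a :: A) ++ b :: B) S.
    by apply: perm_trans pS; apply/permP=> x; rewrite /= !count_cat /=; lia.
  have := IH (b :: A) (a :: B) sz p1 isT; have := IH (a :: A) (b :: B) sz p2 isT.
  set N := map_mx polyC _; rewrite !big_cons; set p := \prod_(w <- B) _.
  rewrite ![weight_factor _ * p]mulrC !rmorphM /= !mulrA; set W := N * _.
  rewrite /weight_factor !rmorphB /= horner_mx_X !horner_mx_C !mulrBr => /eqP.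
  rewrite subr_eq0 => /eqP -> /eqP; rewrite -mulrBr -raddfB -mulmxE mul_mx_scalar.
  rewrite scalemx_eq0 subr_eq0 eq_sym (negPf ab) /=.
  by move/eqP.
have := key S [::]; rewrite cats0 perm_refl big_nil rmorph1 mulr1 => /(_ isT) H.
have [S0|/H {}H] := eqVneq S [::].
  by move: ann; rewrite S0 big_nil rmorph1 => /eqP; rewrite oner_eq0.
apply/eqP; rewrite -subr_eq0; apply/eqP/matrixP=> i j.
by move/matrixP/(_ i j): H; rewrite [in LHS]mxE [in RHS]mxE => /polyC_inj ->; rewrite mxE.
Qed.
End Pencil.

Lemma horner_conj_mx (K : fieldType) n (P A : 'M[K]_n.+1) p : P \is a GRing.unit ->
  horner_mx (conj_mx P A) p = conj_mx P (horner_mx A p).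
Proof.
move=> uP; elim/poly_ind: p => [|p c IH]; first by rewrite !rmorph0 /conj_mx mulr0 mul0r.
rewrite !rmorphD !rmorphM /= !horner_mx_X !horner_mx_C IH conj_mxM // -conj_mxD.
by rewrite -[c%:M]scalemx1 -conj_mxZ -[1%:M]/1 conj_mx1.
Qed.

(** If [x] were farther than the bound from every [a 0 j], summing the absolute values of the
    coordinates of the eigenvector equation would force [u = 0]. The bound does not depend on the
    diagonal. *)
Lemma bauer_fike (K : numFieldType) n (a u : 'rV[K]_n) (N : 'M[K]_n) (x : K) :
  u != 0 -> u *m (diag_mx a + N) = x *: u ->
  exists j, `|x - a 0 j| <= \sum_i \sum_j `|N i j|.
Proof.
move=> u0 H; apply/existsP; apply: contraNT u0 => /existsPn far.
set B := \sum_i _ in far.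
have B0 : 0 <= B by apply: sumr_ge0 => i _; apply: sumr_ge0 => j _.
have gap j : `|u 0 j| * `|x - a 0 j| >= `|u 0 j| * B.
  apply: ler_wpM2l => //; apply/ltW.
  by rewrite real_ltNge ?far ?ger0_real.
have row_eq j : u 0 j * (x - a 0 j) = \sum_i u 0 i * N i j.
  move/rowP/(_ j): H; rewrite mulmxDr mul_mx_diag !mxE mulrBr => E.
  by apply/eqP; rewrite [_ * x]mulrC subr_eq -E addrC.
have le1 : \sum_j `|u 0 j| * `|x - a 0 j| <= \sum_j `|u 0 j| * B.
  under eq_bigr do rewrite -normrM row_eq.
  apply: le_trans (_ : \sum_j \sum_i `|u 0 i| * `|N i j| <= _).
    apply: ler_sum => j _; apply: le_trans (ler_norm_sum _ _ _) _.
    by apply: ler_sum => i _; rewrite normrM.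
  rewrite exchange_big /=; apply: ler_sum => i _; rewrite -mulr_sumr.
  apply: ler_wpM2l => //; rewrite [leRHS](bigD1 i) //= lerDl.
  by apply: sumr_ge0 => ? _; apply: sumr_ge0.
have eqs : \sum_j `|u 0 j| * (`|x - a 0 j| - B) == 0.
  rewrite eq_le; apply/andP; split.
    by under eq_bigr do rewrite mulrBr; rewrite sumrB subr_le0.
  by apply: sumr_ge0 => j _; rewrite mulrBr subr_ge0.
rewrite psumr_eq0 in eqs; last by move=> j _; rewrite mulrBr subr_ge0.
apply/eqP/rowP=> j; rewrite mxE; move/allP/(_ j (mem_index_enum j)): eqs.
rewrite /= mulf_eq0 normr_eq0 => /orP[/eqP->//|]; rewrite subr_eq0 => /eqP e.
by have := far j; rewrite e lexx.
Qed.

Section IntegralPencil.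
Variables (K : numFieldType) (n : nat) (X Y : 'M[K]_n.+1).
Hypothesis archK : forall x : K, exists m : nat, `|x| <= m%:R.
Hypothesis specXY : forall k l : int, exists P (d : 'I_n.+1 -> int),
  P \is a GRing.unit /\ X *~ k + Y *~ l = conj_mx P (diag_mx (\row_i (d i)%:~R)).

(** In an eigenbasis of [X] the matrix [k X + Y] is [k diag(lam) + N], so each of its eigenvalues is
    [k lam_j + c] with [c] an integer bounded independently of [k]. The product over these finitely
    many forms vanishes at every natural [k], hence identically. *)
Lemma integral_pencil_annihilator : exists2 S : seq (int * int), uniq S &
  horner_mx (pencil X Y) (\prod_(w <- S) weight_factor K w) = 0.
Proof.
have [P [lam [uP]]] := specXY 1 0; rewrite mulr1z mulr0z addr0 => EX.
pose N := P * Y * P^-1; have [m Hm] := archK (\sum_i \sum_j `|N i j|).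
(* Shifting [0 .. 2m] by [m] yields all integers of absolute value at most [m]. *)
pose S := undup [seq (lam i, c%:Z - m%:Z) | i <- enum 'I_n.+1, c <- iota 0 (m + m).+1].
exists S; first exact: undup_uniq.
apply: polymx_eq0 => k; rewrite eval_horner_pencil rmorph_prod /=.
have [Q [d [uQ]]] := specXY k 1; rewrite mulr1z -pmulrn -scaler_nat => EQ.
rewrite EQ horner_conj_mx // horner_mx_diag.
suff -> : map_mx (horner (\prod_(w <- S) map_poly (horner_eval k%:R) (weight_factor K w)))
    (\row_i (d i)%:~R) = 0 by rewrite raddf0 /conj_mx mulr0 mul0r.
apply/rowP=> i; rewrite !mxE horner_prod.
have rQ : row i Q *m (k%:R *: X + Y) = (d i)%:~R *: row i Q.
  rewrite EQ /conj_mx -row_mul mulmxE !mulrA mulrV // mul1r.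
  by rewrite -mulmxE row_mul row_diag_mx mxE -scalemxAl -rowE.
have [||j] := @bauer_fike _ _ (k%:R *: \row_i (lam i)%:~R) (row i Q *m P^-1) N (d i)%:~R.
- apply: contraTneq uQ => Q0; rewrite -[_ \is a _]/(Q \in unitmx) -row_free_unit.
  apply/negP=> /row_freeP[B QB]; have := congr1 (row i) QB; rewrite row_mul.
  have -> : row i Q = 0.
    by rewrite -[row i Q](mulmxKV uP) -[invmx P]/(P^-1) Q0 mul0mx.
  rewrite mul0mx => /rowP/(_ i); rewrite !mxE eqxx => /eqP.
  by rewrite eq_sym oner_eq0.
- have -> : diag_mx (k%:R *: \row_i (lam i)%:~R) + N = P * (k%:R *: X + Y) * P^-1.
    rewrite mulrDr mulrDl; congr (_ + _).
    by rewrite -scalerAr -scalerAl EX conj_mxK // linearZ.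
  rewrite -!mulmxE !mulmxA -[P^-1]/(invmx P) (mulmxKV uP).
  by rewrite rQ scalemxAl.
rewrite ger0_norm in Hm; last by apply: sumr_ge0 => *; apply: sumr_ge0.
rewrite !mxE => /le_trans/(_ Hm).
rewrite !pmulrn -intrM -intrB -intr_norm ler_int => Hj.
pose c : int := d i - k%:Z * lam j.
have wS : (lam j, c) \in S.
  rewrite mem_undup; apply/allpairsP; exists (j, absz (c + m%:Z)); rewrite -/c in Hj.
  split; [by rewrite mem_enum | by rewrite [_.2]/= mem_iota; lia | congr (_, _)].
  by rewrite [_.2]/=; lia.
rewrite (big_rem _ wS) /= eval_weight_factor hornerXsubC eval_weight /= /c.
by rewrite intrB intrM -pmulrn [_ * k%:R]mulrC addrCA subrr addr0 subrr mul0r.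
Qed.

(** Two weights may share a slope, so [X] is replaced by [X + a Y]: the weight [(l, m)] becomes
    [(l + a m, m)], and as [a] exceeds twice every [|l|], distinct weights get distinct slopes. *)
Lemma integral_pencil_comm : X * Y = Y * X.
Proof.
have [S uS ann] := integral_pencil_annihilator.
pose a := (\sum_(w <- S) `|w.1|%N).*2.+1.
pose sh (w : int * int) := (w.1 + a%:Z * w.2, w.2).
have absS w : w \in S -> (`|w.1| <= \sum_(w <- S) `|w.1|)%N.
  by move=> wS; rewrite (big_rem w) //= leq_addr.
have annz z : horner_mx (z *: X + Y) (\prod_(w <- S) ('X - ((weight K w).[z])%:P)) = 0.
  have := eval_horner_pencil X Y z (\prod_(w <- S) weight_factor K w).
  rewrite ann map_mx0 rmorph_prod /= => ->; congr horner_mx.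
  by apply: eq_bigr => w _; rewrite eval_weight_factor.
suff : (X + a%:R *: Y) * Y = Y * (X + a%:R *: Y).
  by rewrite mulrDl mulrDr -scalerAl -scalerAr => /addIr.
apply: (@pencil_comm _ _ _ _ (map sh S)).
- apply: polymx_eq0 => k; rewrite eval_horner_pencil.
  pose t : K := (k * a + 1)%:R.
  have t0 : t != 0 by rewrite pnatr_eq0 addn1.
  (* Up to the factor [t = k a + 1], the new pencil at [k] is the old one at [k / t], where the old
     product vanishes. *)
  have -> : k%:R *: (X + a%:R *: Y) + Y = t *: ((k%:R / t) *: X + Y).
    rewrite scalerDr [in RHS]scalerDr !scalerA -addrA [t * _]mulrC divfK //; congr (_ + _).
    by rewrite /t natrD natrM scalerDl scale1r.
  rewrite big_map !rmorph_prod /=.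
  transitivity (t ^+ size S *: horner_mx (k%:R / t *: X + Y)
      (\prod_(w <- S) ('X - ((weight K w).[k%:R / t])%:P))); last by rewrite annz scaler0.
  rewrite rmorph_prod /=; move: (k%:R / t *: X + Y) => M.
  elim: (S) => [|w s IH]; first by rewrite !big_nil scale1r.
  rewrite !big_cons IH -scalerAr [size (w :: s)]/= exprSr -[in RHS]scalerA; congr (_ *: _).
  rewrite scalerAl; congr (_ * _).
  rewrite eval_weight_factor !rmorphB /= !horner_mx_X !horner_mx_C.
  rewrite scalerBr scale_scalar_mx; congr (_ - _%:M).
  rewrite !eval_weight /= intrD intrM /t natrD natrM.
  move: t0; rewrite /t natrD natrM => t0; field.
  by move: t0; rewrite ?natrD ?natrM.
- rewrite -map_comp map_inj_in_uniq // => -[l1 m1] [l2 m2] w1S w2S /= e.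
  have h1 := absS _ w1S; have h2 := absS _ w2S; rewrite /= in h1 h2.
  have em : m1 = m2 by rewrite /a in e; nia.
  by rewrite em in e *; move/addIr: e => ->.
- move=> k l; have [P [d [uP E]]] := specXY k (k * a%:Z + l).
  have -> : (X + a%:R *: Y) *~ k + Y *~ l = X *~ k + Y *~ (k * a%:Z + l).
    rewrite mulrzDl mulrzDr -addrA; congr (_ + (_ + _)).
    by rewrite mulrC mulrzA -pmulrn scaler_nat.
  by rewrite E; apply: diagonalizable_conj.
Qed.

End IntegralPencil.

(** * Generic elements of commuting pairs *)

Lemma eventually_forall (I : finType) (P : I -> nat -> Prop) :
  (forall i, exists k0, forall k, (k0 <= k)%N -> P i k) ->
  exists k0, forall k, (k0 <= k)%N -> forall i, P i k.
Proof.
move=> H; have [f Hf] := fin_all_exists H.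
exists (\max_i f i) => k le i; apply: Hf; apply: leq_trans le.
exact: leq_bigmax.
Qed.

Lemma eventually_not (P : nat -> Prop) :
  (forall k l, (k < l)%N -> P k -> P l -> False) ->
  exists k0, forall k, (k0 <= k)%N -> ~ P k.
Proof.
move=> H; have [[k Pk]|nP] := classic (exists k, P k); last first.
  by exists 0%N => k _ Pk; apply: nP; exists k.
by exists k.+1 => l kl Pl; apply: (H k l).
Qed.

Section Generic.
Variables (K : numFieldType) (n : nat).
Implicit Types S T U V Z : 'M[K]_n.+1.

(** Distinct joint eigenvalues [(s_i, t_i)] collide in [s + k t] for at most one [k]; past all
    collisions, [S + k T] has the commutant of the pair. *)
Lemma generic_comm_add S T : GRing.comm S T -> diagonalizable S -> diagonalizable T ->
  exists k0 : nat, forall k, (k0 <= k)%N -> forall Z, GRing.comm Z (S + T *+ k) ->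
    GRing.comm Z S /\ GRing.comm Z T.
Proof.
move=> cST dS dT; have [P [s [t [uP -> ->]]]] := codiagonalizable_ex cST dS dT.
have [] := @eventually_forall ('I_n.+1 * 'I_n.+1)%type (fun p k =>
  s 0 p.1 + t 0 p.1 *+ k = s 0 p.2 + t 0 p.2 *+ k ->
  s 0 p.1 = s 0 p.2 /\ t 0 p.1 = t 0 p.2).
  move=> [i j] /=; have [e|ne] := eqVneq (t 0 i) (t 0 j).
    by exists 0%N => k _; rewrite e => /addIr.
  have [|k0 Hk0] := @eventually_not (fun k => s 0 i + t 0 i *+ k = s 0 j + t 0 j *+ k).
    move=> k l kl ek el; case/negP: ne; rewrite -subr_eq0.
    suff : (t 0 i - t 0 j) *+ (l - k) == 0 by rewrite mulrn_eq0 subn_eq0 leqNgt kl.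
    rewrite mulrnBr 1?ltnW // !mulrnBl.
    have -> : t 0 i *+ l - t 0 j *+ l = s 0 j - s 0 i.
      by apply/eqP; rewrite subr_eq addrAC -el addrAC subrr add0r.
    have -> : t 0 i *+ k - t 0 j *+ k = s 0 j - s 0 i.
      by apply/eqP; rewrite subr_eq addrAC -ek addrAC subrr add0r.
    by rewrite subrr.
  by exists k0 => k /Hk0.
move=> k0 Hk0; exists k0 => k /Hk0 Hk Z.
have -> : conj_mx P (diag_mx s) + conj_mx P (diag_mx t) *+ k =
    conj_mx P (diag_mx (s + t *+ k)).
  by rewrite -scaler_nat conj_mxZ conj_mxD scaler_nat -raddfMn -raddfD.
move=> cZ; split; apply: comm_diag_transfer uP _ cZ => i j;
  rewrite !mxE !mulmxnE => /(Hk (i, j)) [] //.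
Qed.

(** Here a collision for two values of [k] makes a ratio of eigenvalues of [V] a root of unity; the
    power [N] first turns every such ratio into [1]. *)
Lemma generic_comm_mul U V : GRing.comm U V -> diagonalizable U -> diagonalizable V ->
  U \is a GRing.unit -> V \is a GRing.unit ->
  exists2 N : nat, (0 < N)%N & exists k0 : nat, forall k, (k0 <= k)%N ->
    forall Z, GRing.comm Z (U ^+ N * V ^+ (N * k)) ->
    GRing.comm Z (U ^+ N) /\ GRing.comm Z (V ^+ N).
Proof.
move=> cUV dU dV; have [P [u [v [uP -> ->]]]] := codiagonalizable_ex cUV dU dV.
have unz (a : 'rV[K]_n.+1) : conj_mx P (diag_mx a) \is a GRing.unit -> forall i, a 0 i != 0.
  move=> ua i; apply: contraTneq ua => ai0.
  rewrite unitmxE -[conj_mx _ _]/(P^-1 *m diag_mx a *m P) !det_mulmx det_diag.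
  by rewrite (bigD1 i) //= ai0 !(mul0r, mulr0) unitr0.
move=> /unz u0 /unz v0.
(* A pair whose ratio is not a root of unity gets the dummy exponent [1]. *)
have torsion_exp (p : 'I_n.+1 * 'I_n.+1) : exists N, (0 < N)%N /\
    ((exists2 m, (0 < m)%N & v 0 p.1 ^+ m = v 0 p.2 ^+ m) -> v 0 p.1 ^+ N = v 0 p.2 ^+ N).
  have [[m m0 e]|ne] := classic (exists2 m, (0 < m)%N & v 0 p.1 ^+ m = v 0 p.2 ^+ m).
    by exists m.
  by exists 1%N; split.
have [f Hf] := fin_all_exists torsion_exp.
pose N := (\prod_p f p)%N; have N0 : (0 < N)%N.
  by apply: prodn_gt0 => p; have [] := Hf p.
exists N => //.
have [] := @eventually_forall ('I_n.+1 * 'I_n.+1)%type (fun p k =>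
  u 0 p.1 ^+ N * v 0 p.1 ^+ (N * k) = u 0 p.2 ^+ N * v 0 p.2 ^+ (N * k) ->
  u 0 p.1 ^+ N = u 0 p.2 ^+ N /\ v 0 p.1 ^+ N = v 0 p.2 ^+ N).
  move=> [i j] /=; have [fp0 tor] := Hf (i, j).
  have [/tor /= e|nt] := classic (exists2 m, (0 < m)%N & v 0 i ^+ m = v 0 j ^+ m).
    have eN : v 0 i ^+ N = v 0 j ^+ N by rewrite /N (bigD1 (i, j)) //= !exprM e.
    exists 0%N => k _; rewrite !exprM eN => /mulIf -> //.
    by rewrite !expf_neq0.
  have [|k0 Hk0] := @eventually_not (fun k => u 0 i ^+ N * v 0 i ^+ (N * k) =
                                             u 0 j ^+ N * v 0 j ^+ (N * k)).
    move=> k l kl ek el; case: nt; exists (N * (l - k))%N.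
      by rewrite muln_gt0 N0 subn_gt0.
    move: el; rewrite -(subnKC (ltnW kl)) mulnDr !exprD !mulrA ek.
    by rewrite addKn => /mulfI -> //; rewrite mulf_neq0 // expf_neq0.
  by exists k0 => k /Hk0.
move=> k0 Hk0; exists k0 => k /Hk0 Hk Z.
rewrite !conj_mxX // conj_mxM // !diag_mxX diag_mxM => cZ.
by split; apply: comm_diag_transfer uP _ cZ => i j; rewrite !mxE => /(Hk (i, j)) [].
Qed.
End Generic.

(** * Truncated exponentials and norms *)

Section ExpPartial.
Variables (F : numFieldType) (L : algType F).
Implicit Types A B : L.

Definition expp A N : L := \sum_(k < N.+1) (k`!%:R : F)^-1 *: A ^+ k.

Lemma sum_triangle (V : nmodType) (N : nat) (f : nat -> nat -> V) :
  \sum_(p < N.+1) \sum_(q < N.+1 | (p + q <= N)%N) f p q =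
  \sum_(m < N.+1) \sum_(q < m.+1) f (m - q)%N q.
Proof.
have -> : \sum_(p < N.+1) \sum_(q < N.+1 | (p + q <= N)%N) f p q =
    \sum_(m < N.+1) \sum_(q < N.+1) \sum_(p < N.+1 | (p + q)%N == m :> nat) f p q.
  rewrite (exchange_big_dep xpredT) //= [RHS]exchange_big /=; apply: eq_bigr => q _.
  rewrite (exchange_big_dep (fun p : 'I_N.+1 => p + q <= N)%N) /=; last first.
    by move=> m p _ /eqP e; rewrite e -ltnS.
  apply: eq_bigr => p pq; rewrite (big_pred1 (inord (p + q))) // => m /=.
  by rewrite -val_eqE /= inordK // eq_sym.
apply: eq_bigr => m _.
rewrite (big_ord_widen N.+1 (fun q => f (m - q)%N q)) //= [RHS]big_mkcond /=.
apply: eq_bigr => q _; case: ifP => qm.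
  rewrite (big_pred1 (inord (m - q))) => [|p /=].
    by rewrite inordK // ltnS; have := ltn_ord m; lia.
  rewrite -val_eqE /= inordK; last by have := ltn_ord m; lia.
  by apply/eqP/eqP; lia.
by rewrite big_pred0 // => p; apply/eqP; lia.
Qed.

(** The remainder has positive coefficients, the same in every algebra, so for matrices it is
    dominated by the remainder for their norms. *)
Lemma exppD A B N : GRing.comm A B ->
  expp A N * expp B N = expp (A + B) N +
  \sum_(p < N.+1) \sum_(q < N.+1 | (N < p + q)%N)
    ((p`!%:R : F)^-1 * (q`!%:R)^-1) *: (A ^+ p * B ^+ q).
Proof.
move=> cAB; pose f p q := ((p`!%:R : F)^-1 * (q`!%:R)^-1) *: (A ^+ p * B ^+ q).
have -> : expp (A + B) N = \sum_(p < N.+1) \sum_(q < N.+1 | (p + q <= N)%N) f p q.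
  rewrite sum_triangle; apply: eq_bigr => m _; rewrite exprDn_comm // scaler_sumr.
  apply: eq_bigr => q _; rewrite /f -scaler_nat scalerA; congr (_ *: _).
  have fa k : (k`!%:R : F) != 0 by rewrite pnatr_eq0 -lt0n fact_gt0.
  have qm : (q <= m)%N by rewrite -ltnS.
  by rewrite -(bin_fact qm) !natrM; field; rewrite !fa pnatr_eq0 -lt0n bin_gt0 qm.
rewrite -big_split /= /expp mulr_suml; apply: eq_bigr => p _.
rewrite mulr_sumr (bigID (fun q : 'I_N.+1 => p + q <= N)%N) /=; congr (_ + _).
  by apply: eq_bigr => q _; rewrite /f -scalerAl -scalerAr scalerA.
apply: eq_big => [q|q _]; first by rewrite -ltnNge.
by rewrite -scalerAl -scalerAr scalerA.
Qed.
End ExpPartial.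

(** * A submultiplicative norm and majorants by the real exponential *)

Section Norm.
Variables (R : rcfType) (n : nat).
Local Notation CC := (R[i]).
Implicit Types A B E : 'M[CC]_n.+1.

(** The sum norm of the plane, with values in [R], whereas the modulus on [R[i]] takes its values in
    [R[i]]. *)
Definition cnorm1 (z : CC) : R := `|complex.Re z| + `|complex.Im z|.
Definition mxnorm1 A : R := \sum_i \sum_j cnorm1 (A i j).

Lemma cnorm1_ge0 z : 0 <= cnorm1 z.
Proof. by rewrite addr_ge0. Qed.

Lemma cnorm1D z w : cnorm1 (z + w) <= cnorm1 z + cnorm1 w.
Proof.
case: z => a b; case: w => c d; rewrite /cnorm1 /=.
by rewrite addrACA lerD // ler_normD.
Qed.

Lemma cnorm1M z w : cnorm1 (z * w) <= cnorm1 z * cnorm1 w.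
Proof.
case: z => a b; case: w => c d; rewrite /cnorm1 /=.
apply: le_trans (lerD (ler_normB _ _) (ler_normD _ _)) _.
by rewrite !normrM le_eqVlt; apply/orP; left; apply/eqP; ring.
Qed.

Lemma cnorm1N z : cnorm1 (- z) = cnorm1 z.
Proof. by case: z => a b; rewrite /cnorm1 /= !normrN. Qed.

Lemma cnorm1Vnat k z : cnorm1 ((k%:R)^-1 * z) = (k%:R)^-1 * cnorm1 z.
Proof.
have -> : (k%:R)^-1 = (((k%:R)^-1)%:C)%C :> CC by rewrite fmorphV rmorph_nat.
case: z => a b; rewrite /cnorm1 /= !mul0r subr0 addr0 !normrM mulrDr.
by rewrite ger0_norm // invr_ge0.
Qed.

Lemma cnorm1_sum (I : finType) (P : pred I) (f : I -> CC) :
  cnorm1 (\sum_(i | P i) f i) <= \sum_(i | P i) cnorm1 (f i).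
Proof.
elim/big_ind2: _ => [|a x b y ha hb|//]. by rewrite /cnorm1 /= !normr0 addr0.
by apply: le_trans (cnorm1D _ _) _; apply: lerD.
Qed.

Lemma mxnorm1_ge0 A : 0 <= mxnorm1 A.
Proof. by apply: sumr_ge0 => i _; apply: sumr_ge0 => j _; apply: cnorm1_ge0. Qed.

Lemma cnorm1_le_mx A i j : cnorm1 (A i j) <= mxnorm1 A.
Proof.
rewrite /mxnorm1 (bigD1 i) //= (bigD1 j) //= -addrA lerDl addr_ge0 //.
  by apply: sumr_ge0 => k _; apply: cnorm1_ge0.
by apply: sumr_ge0 => k _; apply: sumr_ge0 => l _; apply: cnorm1_ge0.
Qed.

Lemma mxnorm1D A B : mxnorm1 (A + B) <= mxnorm1 A + mxnorm1 B.
Proof.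
rewrite /mxnorm1 -big_split; apply: ler_sum => i _; rewrite -big_split.
by apply: ler_sum => j _; rewrite mxE cnorm1D.
Qed.

Lemma mxnorm1N A : mxnorm1 (- A) = mxnorm1 A.
Proof.
by apply: eq_bigr => i _; apply: eq_bigr => j _; rewrite mxE cnorm1N.
Qed.

Lemma mxnorm1_0 : mxnorm1 0 = 0.
Proof.
by rewrite /mxnorm1 big1 // => i _; rewrite big1 // => j _; rewrite mxE /cnorm1 /= !normr0 addr0.
Qed.

Lemma mxnorm1_eq0 A : mxnorm1 A = 0 -> A = 0.
Proof.
move=> A0; apply/matrixP=> i j; rewrite mxE.
have : cnorm1 (A i j) <= 0 by rewrite -A0 cnorm1_le_mx.
case: (A i j) => a b; rewrite /cnorm1 /= => h.
have /eqP : `|a| + `|b| = 0 by apply/eqP; rewrite eq_le h addr_ge0.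
by rewrite paddr_eq0 // !normr_eq0 => /andP[/eqP-> /eqP->].
Qed.

Lemma mxnorm1M A B : mxnorm1 (A * B) <= mxnorm1 A * mxnorm1 B.
Proof.
rewrite /mxnorm1 mulr_suml; apply: ler_sum => i _.
apply: le_trans (_ : \sum_j \sum_k cnorm1 (A i k) * cnorm1 (B k j) <= _).
  apply: ler_sum => j _; rewrite mxE; apply: le_trans (cnorm1_sum _ _) _.
  by apply: ler_sum => k _; apply: cnorm1M.
rewrite exchange_big mulr_suml /=; apply: ler_sum => k _.
rewrite -mulr_sumr; apply: ler_wpM2l; first exact: cnorm1_ge0.
rewrite [leRHS](bigD1 k) //= lerDl.
by apply: sumr_ge0 => l _; apply: sumr_ge0 => j _; apply: cnorm1_ge0.
Qed.

(** The case [k = 0] is left out because [mxnorm1 1] is [n.+1]. *)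
Lemma mxnorm1X A k : (0 < k)%N -> mxnorm1 (A ^+ k) <= mxnorm1 A ^+ k.
Proof.
case: k => // k _; elim: k => [|k IH]; first by rewrite !expr1.
rewrite exprS [leRHS]exprS; apply: le_trans (mxnorm1M _ _) _.
by apply: ler_wpM2l => //; apply: mxnorm1_ge0.
Qed.

Lemma mxnorm1Vnat k A : mxnorm1 ((k%:R)^-1 *: A) = (k%:R)^-1 * mxnorm1 A.
Proof.
rewrite /mxnorm1 mulr_sumr; apply: eq_bigr => i _; rewrite mulr_sumr.
by apply: eq_bigr => j _; rewrite mxE cnorm1Vnat.
Qed.

Lemma mxnorm1_sum (I : finType) (P : pred I) (f : I -> 'M[CC]_n.+1) :
  mxnorm1 (\sum_(i | P i) f i) <= \sum_(i | P i) mxnorm1 (f i).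
Proof.
elim/big_ind2: _ => [|a x b y ha hb|//]; first by rewrite mxnorm1_0.
by apply: le_trans (mxnorm1D _ _) _; apply: lerD.
Qed.

Local Notation rexp := (@expp R (R^o)).

Lemma mxnorm1_exppD A B N : GRing.comm A B ->
  mxnorm1 (expp A N * expp B N - expp (A + B) N) <=
  rexp (mxnorm1 A) N * rexp (mxnorm1 B) N - rexp (mxnorm1 A + mxnorm1 B) N.
Proof.
move=> cAB; rewrite !exppD //; last exact: mulrC.
rewrite addrC addKr [leRHS]addrC addKr.
apply: le_trans (mxnorm1_sum _ _) _; apply: ler_sum => p _.
apply: le_trans (mxnorm1_sum _ _) _; apply: ler_sum => q pq.
rewrite -scalerA !mxnorm1Vnat -[leRHS]/(_ * _) -mulrA.
do 2 (apply: ler_wpM2l; first by rewrite invr_ge0).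
apply: le_trans (mxnorm1M _ _) _; apply: ler_pM; rewrite ?mxnorm1_ge0 //.
  (* From [p, q <= N < p + q], both exponents are positive. *)
  by apply: mxnorm1X; have := ltn_ord q; lia.
by apply: mxnorm1X; have := ltn_ord p; lia.
Qed.

Lemma mxnorm1_exppB A N M : (N <= M)%N ->
  mxnorm1 (expp A M - expp A N) <= rexp (mxnorm1 A) M - rexp (mxnorm1 A) N.
Proof.
move=> /subnK <-; elim: (M - N)%N => [|k IH]; first by rewrite add0n !subrr mxnorm1_0.
rewrite addSn /expp big_ord_recr [in leRHS]big_ord_recr /=.
rewrite -addrAC [leRHS]addrAC; apply: le_trans (mxnorm1D _ _) _; apply: lerD => //.
rewrite mxnorm1Vnat -[leRHS]/(_ * _); apply: ler_wpM2l; first by rewrite invr_ge0.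
exact: mxnorm1X.
Qed.
End Norm.

(** * Subgroups on which an exponential is a homomorphism *)

(** Applied to a truncation of [e^X - 1], this provides a polynomial logarithm. *)
Lemma poly_comp_inverse (K : fieldType) (u : {poly K}) m : u.[0] = 1 ->
  exists L : {poly K}, 'X^(m.+1) %| (L \Po ('X * u)) - 'X.
Proof.
move=> u0; elim: m => [|m [L /dvdpP[q Hq]]].
  by exists 0; rewrite comp_poly0 sub0r dvdpNr expr1 dvdpp.
(* [q.[0]] is the coefficient of ['X^(m.+1)] in the error; since [u.[0] = 1], this correction of [L]
   cancels it. *)
exists (L - q.[0] *: 'X^(m.+1)).
rewrite comp_polyB comp_polyZ comp_Xn_poly addrAC Hq exprMn.
have -> : q * 'X^(m.+1) - q.[0] *: ('X^(m.+1) * u ^+ m.+1) =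
    (q - q.[0] *: u ^+ m.+1) * 'X^(m.+1).
  by rewrite mulrBl -scalerAl [u ^+ _ * _]mulrC.
rewrite exprS dvdp_mul // -['X]subr0 dvdp_XsubCl rootE hornerD hornerN hornerZ.
by rewrite horner_exp u0 expr1n mulr1 subrr.
Qed.

Section AbstractExponential.
Variables (K : numClosedFieldType) (n : nat).
Variables (cexp : K -> K) (tau : K) (expm : 'M[K]_n.+1 -> 'M[K]_n.+1).
Hypothesis complex_archimedean : forall x : K, exists m : nat, `|x| <= m%:R.
Hypothesis tau_neq0 : tau != 0.
Hypothesis cexp_eq1 : forall z, cexp z = 1 -> exists k : int, z = k%:~R * tau.
Hypothesis expmD : forall A B, GRing.comm A B -> expm (A + B) = expm A * expm B.
Hypothesis expm_conj : forall P A, P \is a GRing.unit ->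
  expm (conj_mx P A) = conj_mx P (expm A).
Hypothesis expm_comm : forall A Z, GRing.comm Z A -> GRing.comm Z (expm A).
Hypothesis expm_nilpotent : forall A m, A ^+ m.+1 = 0 -> expm A = expp A m.
Hypothesis expm_diag : forall d : 'rV[K]_n.+1,
  expm (diag_mx d) = diag_mx (\row_i cexp (d 0 i)).
Implicit Types (A B D E M Z X Y U S N P : 'M[K]_n.+1).

Lemma expm0 : expm 0 = 1.
Proof.
by rewrite (@expm_nilpotent _ 0) ?expr1 // /expp big_ord1 expr0 fact0 invr1 scale1r.
Qed.

Lemma expmNM A : expm (- A) * expm A = 1.
Proof.
rewrite -expmD ?addNr ?expm0 //; exact/commr_sym/commrN.
Qed.

Lemma expm_unit A : expm A \is a GRing.unit.
Proof.
apply/unitrP; exists (expm (- A)); split; first exact: expmNM.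
by rewrite -{1}[A]opprK expmNM.
Qed.

Lemma expmMn A k : expm (A *+ k) = expm A ^+ k.
Proof.
elim: k => [|k IH]; first by rewrite mulr0n expm0.
by rewrite mulrS expmD ?IH ?exprS //; apply: commrMn.
Qed.
(** [u] truncates the series [(e^X - 1) / X] and depends only on the bound for the nilpotency
    index. *)
Lemma expm_nilpotent_horner m : exists2 u : {poly K}, u.[0] = 1 &
  forall M, M ^+ m.+2 = 0 -> expm M - 1 = horner_mx M ('X * u).
Proof.
exists (\sum_(k < m.+1) (k.+1`!%:R)^-1 *: 'X^k).
  rewrite big_ord_recl hornerD hornerZ hornerXn expr0 mulr1 invr1 horner_sum.
  by rewrite big1 ?addr0 // => k _; rewrite hornerZ hornerXn expr0n mulr0.
move=> M M0; rewrite (expm_nilpotent M0) /expp big_ord_recl expr0 invr1 scale1r.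
rewrite addrC addKr mulr_sumr rmorph_sum /=; apply: eq_bigr => k _.
by rewrite -scalerAr -exprS linearZ rmorphXn /= horner_mx_X.
Qed.

(** One truncated logarithm serves for all [M] of bounded index, whence the injectivity of the
    exponential on nilpotent matrices. *)
Lemma expm_nilpotent_log m : exists L : {poly K},
  forall M, M ^+ m.+2 = 0 -> M = horner_mx (expm M - 1) L.
Proof.
have [u u0 Hu] := expm_nilpotent_horner m.
have [L /dvdpP[q Hq]] := poly_comp_inverse m.+1 u0.
exists L => M M0; rewrite (Hu M M0).
have -> : horner_mx (horner_mx M ('X * u)) L = horner_mx M (L \Po ('X * u)).
  move: ('X * u) => W; elim/poly_ind: L {Hq} => [|p c IH]; first by rewrite comp_poly0 !rmorph0.
  rewrite comp_poly_MXaddC !rmorphD /= !horner_mx_C; congr (_ + _).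
  by rewrite [LHS]rmorphM [RHS]rmorphM /= IH horner_mx_X.
rewrite -[L \Po _](subrK 'X) Hq rmorphD rmorphM rmorphXn /= horner_mx_X M0.
by rewrite mulr0 add0r.
Qed.

Lemma nilpotent_mx_pow M : nilpotent_mx M -> exists m, forall k, (m <= k)%N -> M ^+ k.+2 = 0.
Proof.
case=> p Mp; exists p => k pk.
by rewrite (_ : k.+2 = p + (k.+2 - p))%N ?exprD ?Mp ?mul0r //; lia.
Qed.

Lemma expm_nilpotent_inj M M' : nilpotent_mx M -> nilpotent_mx M' ->
  expm M = expm M' -> M = M'.
Proof.
move=> /nilpotent_mx_pow[p Hp] /nilpotent_mx_pow[q Hq] e.
have [L HL] := expm_nilpotent_log (p + q).
transitivity (horner_mx (expm M - 1) L); first by apply: HL; apply: Hp; lia.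
by rewrite e; apply/esym/HL; apply: Hq; lia.
Qed.

Lemma expm_nilpotent_bicomm M Z : nilpotent_mx M ->
  GRing.comm Z (expm M) -> GRing.comm Z M.
Proof.
move=> /nilpotent_mx_pow[p Hp] cZ; have [L HL] := expm_nilpotent_log p.
have -> := HL M (Hp p (leqnn p)); apply: comm_mx_horner; apply: commrB => //; exact: commr1.
Qed.

Lemma expm_nilpotent_sub1 M : nilpotent_mx M -> nilpotent_mx (expm M - 1).
Proof.
move=> nM; have [p Hp] := nilpotent_mx_pow nM.
have [u _ ->] := expm_nilpotent_horner p; last exact: Hp.
rewrite rmorphM /= horner_mx_X; apply: nilpotent_mxM => //.
exact: comm_mx_horner.
Qed.

Lemma expm_diagonalizable D : diagonalizable D -> diagonalizable (expm D).
Proof.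
case/diagonalizable_ex=> P [d [uP ->]]; rewrite expm_conj // expm_diag.
exact: diagonalizable_conj.
Qed.

Definition dunford M D := [/\ diagonalizable D, nilpotent_mx (M - D) & GRing.comm M D].

Lemma dunford_part M : exists D, dunford M D.
Proof.
have [D [dD nD [p Dp]]] := dunford_exists M; exists D; split=> //.
by rewrite Dp; apply: comm_mx_horner.
Qed.

Lemma dunford_expm_mul S N : diagonalizable S -> nilpotent_mx N -> GRing.comm S N ->
  dunford (S * expm N) S.
Proof.
move=> dS nN cSN; have cSe := expm_comm cSN; split=> //.
  have -> : S * expm N - S = (expm N - 1) * S.
    by rewrite mulrBl mul1r cSe.
  apply: nilpotent_mxM; last exact: expm_nilpotent_sub1.
  exact/commr_sym/commrB/commr1.
by apply/commr_sym/commrM.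
Qed.

Lemma dunford_expm M D : dunford M D ->
  expm M = expm D * expm (M - D) /\ dunford (expm M) (expm D).
Proof.
case=> dD nD cD; have cDN : GRing.comm D (M - D) by apply: commrB => //; exact: commr_sym.
have E : expm M = expm D * expm (M - D) by rewrite -(expmD cDN) addrC subrK.
split; [exact: E | rewrite E].
apply: (dunford_expm_mul (expm_diagonalizable dD) nD).
exact/commr_sym/expm_comm/commr_sym.
Qed.

(** [expm D] is the semisimple part of [expm M], and [M - D] is a polynomial in the unipotent part.
    Commutation with [D] itself cannot be expected, as the exponential may identify eigenvalues of
    [D]. *)
Lemma expm_bicomm M D Z : dunford M D -> GRing.comm Z (expm M) ->
  GRing.comm Z (expm D) /\ GRing.comm Z (M - D).
Proof.
move=> dMD cZ; have [E [dE nE cE]] := dunford_expm dMD; case: dMD => dD nD cD.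
have cZD : GRing.comm Z (expm D) := dunford_bicomm dE nE cE cZ.
split=> //; apply: expm_nilpotent_bicomm => //.
have -> : expm (M - D) = (expm D)^-1 * expm M by rewrite E mulKr ?expm_unit.
by apply: commrM => //; apply: commrV.
Qed.

(** Uniqueness of the decomposition of [1] gives [expm D = 1], injectivity on nilpotent matrices
    then gives [M = D], and the eigenvalues of [D] are periods. *)
Lemma expm_eq1 M : expm M = 1 -> exists P (d : 'I_n.+1 -> int),
  P \is a GRing.unit /\ M = conj_mx P (tau *: diag_mx (\row_i (d i)%:~R)).
Proof.
move=> M1; have [D dMD] := dunford_part M; have [E [dE nE cE]] := dunford_expm dMD.
have D1 : expm D = 1.
  apply: dunford_unique dE nE cE _ _ _; rewrite ?M1.
  - exact: diagonalizable_scalar.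
  - by exists 1%N; rewrite subrr expr1.
  - exact: commr1.
case: dMD => dD nD cD.
have N0 : M - D = 0.
  apply: expm_nilpotent_inj => //; first by exists 1%N; rewrite expr1.
  by rewrite expm0 -M1 E D1 mul1r.
have -> : M = D by apply/eqP; rewrite -subr_eq0 N0.
have [P [d [uP ED]]] := diagonalizable_ex dD.
have Hd i : exists k : int, d 0 i = k%:~R * tau.
  apply: cexp_eq1; move: D1; rewrite ED expm_conj // expm_diag -(conj_mx1 uP).
  move/(conj_mx_inj uP)/matrixP/(_ i i); rewrite !mxE eqxx mulr1n.
  by [].
have [k Hk] := fin_all_exists Hd; exists P, k; split=> //.
rewrite ED -linearZ; congr (conj_mx _ (diag_mx _)); apply/rowP=> i.
by rewrite !mxE Hk mulrC.
Qed.

(** One logarithm is chosen for each value of [cexp], so the eigenvalues of [A0] are functions of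
    those of [expm A] and [A0] lies in the bicommutant of [expm A]. *)
Lemma spectral_log A : diagonalizable A -> exists2 A0, expm A0 = expm A &
  forall Z, GRing.comm Z (expm A) -> GRing.comm Z A0.
Proof.
case/diagonalizable_ex=> P [a [uP ->]].
pose L w := epsilon (inhabits (0 : K)) (fun z => cexp z = w).
have LK z : cexp (L (cexp z)) = cexp z.
  exact: (epsilon_spec _ (fun y => cexp y = cexp z) (ex_intro _ z erefl)).
exists (conj_mx P (diag_mx (\row_i L (cexp (a 0 i))))).
  rewrite !expm_conj // !expm_diag; congr (conj_mx _ (diag_mx _)).
  by apply/rowP=> i; rewrite !mxE LK.
move=> Z; rewrite expm_conj // expm_diag; apply: comm_diag_transfer => // i j.
by rewrite !mxE => ->.
Qed.

Lemma comm_mulrn_inv Z A (N : nat) : (0 < N)%N -> GRing.comm Z (A *+ N) -> GRing.comm Z A.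
Proof.
move=> N0; rewrite -scaler_nat /GRing.comm -scalerAr -scalerAl.
by move/scalerI; apply; rewrite pnatr_eq0 -lt0n.
Qed.

Section Subgroup.
Variable (G : 'M[K]_n.+1 -> Prop).
Hypothesis GD : forall A B, G A -> G B -> G (A + B).
Hypothesis GN : forall A, G A -> G (- A).
Hypothesis expG : forall A B, G A -> G B -> expm (A + B) = expm A * expm B.

Lemma expm_subgroup_comm A B : G A -> G B -> GRing.comm (expm A) (expm B).
Proof. by move=> GA GB; rewrite /GRing.comm -!expG // addrC. Qed.

Lemma subgroup_mulrn A k : G A -> G (A *+ k.+1).
Proof. by move=> GA; elim: k => [|k IH] //; rewrite mulrS; apply: GD. Qed.

Lemma subgroup_mulrz A k : G A -> G (A *~ k).
Proof.
move=> GA; have G0 : G 0 by rewrite -(subrr A); apply: GD => //; apply: GN.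
have Gn m : G (A *+ m) by case: m => // m; apply: subgroup_mulrn.
by case: k => m; [apply: Gn | rewrite NegzE mulrNz; apply/GN/Gn].
Qed.

(** As [expm A] and [expm B] commute, so do their semisimple parts and the nilpotent parts [N], [M].
    Thus [expm (A + B)] is [expm D * expm E] times [expm (N + M)], which is its decomposition, and
    injectivity on nilpotent matrices makes [N + M] the nilpotent part of [A + B]. *)
Lemma dunford_subgroupD A B D E : G A -> G B -> dunford A D -> dunford B E ->
  [/\ dunford (A + B) (D + E), expm (D + E) = expm D * expm E
    & GRing.comm (A - D) (B - E)].
Proof.
move=> GA GB dA dB; have cU := expm_subgroup_comm GA GB.
have [cAE cAM] := expm_bicomm dB cU.
have [cED cEN] := expm_bicomm dA (commr_sym cAE).
have [cMD cMN] := expm_bicomm dA (commr_sym cAM).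
have [EA [dSA _ _]] := dunford_expm dA; have [EB [dSB _ _]] := dunford_expm dB.
have [_ nA cAD] := dA; have [_ nB cBE] := dB.
have cDN : GRing.comm (expm D) (A - D).
  by apply/commr_sym/expm_comm/commr_sym/commrB => //; exact: commr_sym.
have cEM : GRing.comm (expm E) (B - E).
  by apply/commr_sym/expm_comm/commr_sym/commrB => //; exact: commr_sym.
set N := A - D in EA cEN cMN cDN nA *; set M := B - E in EB cMD cMN cEM nB *.
have cNM : GRing.comm N M by exact: commr_sym.
have [F dF] := dunford_part (A + B); have [EF [dSF nSF cSF]] := dunford_expm dF.
have ES : expm (A + B) = expm D * expm E * expm (N + M).
  rewrite expG // EA EB (expmD cNM) -!mulrA; congr (_ * _); rewrite !mulrA; congr (_ * _).
  exact/commr_sym/expm_comm.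
have cS : GRing.comm (expm D * expm E) (N + M).
  by apply/commr_sym/commrM; apply/commr_sym/commrD => //; apply: commr_sym.
have nNM : nilpotent_mx (N + M) by apply: nilpotent_mxD.
have [dS nS cSS] : dunford (expm (A + B)) (expm D * expm E).
  by rewrite ES; apply: dunford_expm_mul => //; apply: diagonalizableM => //; apply: commr_sym.
have FS : expm F = expm D * expm E := dunford_unique dSF nSF cSF dS nS cSS.
have EN : A + B - F = N + M.
  have [_ nF _] := dF; apply: expm_nilpotent_inj => //.
  by apply: (mulrI (expm_unit F)); rewrite -EF ES FS.
(* The diagonalizable part is reached by subtraction, since [expm F = expm D * expm E] does not
   determine [F]. *)
have FDE : F = D + E.
  by move: EN; rewrite /N /M addrACA -opprD => /addrI/oppr_inj.
by rewrite -FDE; split.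
Qed.
End Subgroup.

Lemma expm_lattice1_comm X Y : (forall k l : int, expm (X *~ k + Y *~ l) = 1) ->
  X * Y = Y * X.
Proof.
move=> H; set t := tau^-1.
have t0 : t != 0 by rewrite invr_eq0 tau_neq0.
suff : (t *: X) * (t *: Y) = (t *: Y) * (t *: X).
  by rewrite -!scalerAl -!scalerAr => /(scalerI t0)/(scalerI t0).
apply: integral_pencil_comm; first exact: complex_archimedean.
move=> k l; have [P [d [uP E]]] := expm_eq1 (H k l); exists P, d; split=> //.
rewrite -!scaler_int !scalerA ![_ * t]mulrC -!scalerA -scalerDr !scaler_int E.
by rewrite -conj_mxZ scalerA mulVf ?tau_neq0 // scale1r.
Qed.

Lemma expm_mulrz1 X k : expm X = 1 -> expm (X *~ k) = 1.
Proof.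
move=> X1; have Xn m : expm (X *+ m) = 1 by rewrite expmMn X1 expr1n.
case: k => m; first exact: Xn.
by rewrite NegzE mulrNz -pmulrn -[LHS]mulr1 -(Xn m.+1) expmNM.
Qed.

(* With [e^A], [e^B] central for [A], [B], subtracting spectral logarithms reduces
   to a lattice on which [exp] is constantly [1]. *)
Lemma diagonalizable_central_comm (G : 'M[K]_n.+1 -> Prop) A B :
  (forall A B, G A -> G B -> G (A + B)) -> (forall A, G A -> G (- A)) ->
  (forall A B, G A -> G B -> expm (A + B) = expm A * expm B) ->
  G A -> G B -> diagonalizable A -> diagonalizable B ->
  GRing.comm A (expm B) -> GRing.comm B (expm A) -> A * B = B * A.
Proof.
move=> GD GN expG GA GB dA dB cAV cBU.
have [A0 eA0 bA0] := spectral_log dA; have [B0 eB0 bB0] := spectral_log dB.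
have cAA0 : GRing.comm A A0 by apply/bA0/expm_comm.
have cBB0 : GRing.comm B B0 by apply/bB0/expm_comm.
have cAB0 : GRing.comm A B0 by apply: bB0.
have cBA0 : GRing.comm B A0 by apply: bA0.
have cA0B0 : GRing.comm A0 B0.
  exact/bB0/commr_sym/bA0/(expm_subgroup_comm expG).
pose X := A - A0; pose Y := B - B0.
have cX0 : GRing.comm X A0 by apply/commr_sym/commrB => //; exact: commr_sym.
have cX1 : GRing.comm X B0 by apply/commr_sym/commrB; exact: commr_sym.
have cY0 : GRing.comm Y A0 by apply/commr_sym/commrB => //; exact: commr_sym.
have cY1 : GRing.comm Y B0 by apply/commr_sym/commrB => //; exact: commr_sym.
have eX : expm X = 1.
  apply: (mulIr (expm_unit A0)); rewrite -expmD // subrK mul1r; exact: esym.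
have eY : expm Y = 1.
  apply: (mulIr (expm_unit B0)); rewrite -expmD // subrK mul1r; exact: esym.
(* The product of [expm (k X + l Y)] and [expm (k A0 + l B0)] is [expm (k A + l B)]. By the
   hypothesis on [G] this is [expm (k A) * expm (l B)], which equals [expm (k A0) * expm (l B0)], so
   the first factor is [1]. *)
have XY : X * Y = Y * X.
  apply: expm_lattice1_comm => k l.
  have ck : GRing.comm (A0 *~ k) (B0 *~ l) by apply/commrMz/commr_sym/commrMz/commr_sym.
  apply: (mulIr (expm_unit (A0 *~ k + B0 *~ l))).
  rewrite mul1r -expmD; last first.
    apply/commr_sym; apply: commrD; apply: commrMz; apply/commr_sym/commrD;
      by apply: commrMz.
  have -> : X *~ k + Y *~ l + (A0 *~ k + B0 *~ l) = A *~ k + B *~ l.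
    by rewrite addrACA -!mulrzDl !subrK.
  rewrite expG; try exact: subgroup_mulrz.
  rewrite expmD //; congr (_ * _).
    rewrite -[A](subrK A0) mulrzDl expmD ?(expm_mulrz1 _ eX) ?mul1r //.
    by apply/commrMz/commr_sym/commrMz/commr_sym.
  rewrite -[B](subrK B0) mulrzDl expmD ?(expm_mulrz1 _ eY) ?mul1r //.
  by apply/commrMz/commr_sym/commrMz/commr_sym.
rewrite -[A](subrK A0) -[B](subrK B0) -/X -/Y.
have cXB : GRing.comm X (Y + B0) by apply: commrD.
have cAB : GRing.comm A0 (Y + B0) by apply: commrD => //; exact: commr_sym.
by rewrite [LHS]mulrDl [RHS]mulrDr cXB cAB.
Qed.

Lemma comm_pencil_split U A B (k0 : nat) :
  (forall k, (k0 <= k)%N -> GRing.comm U (A + B *+ k)) ->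
  GRing.comm U A /\ GRing.comm U B.
Proof.
move=> HU; have h1 := HU k0 (leqnn _); have h2 := HU k0.+1 (leqnSn _).
have cB : GRing.comm U B.
  have -> : B = (A + B *+ k0.+1) - (A + B *+ k0).
    by rewrite opprD addrACA subrr add0r mulrS addrK.
  exact: commrB.
split=> //; have -> : A = (A + B *+ k0) - B *+ k0 by rewrite addrK.
by apply: commrB => //; apply: commrMn.
Qed.

Lemma diagonalizable_subgroup_comm (G : 'M[K]_n.+1 -> Prop) A B :
  (forall A B, G A -> G B -> G (A + B)) -> (forall A, G A -> G (- A)) ->
  (forall A B, G A -> G B -> expm (A + B) = expm A * expm B) ->
  (forall A, G A -> diagonalizable A) ->
  G A -> G B -> A * B = B * A.
Proof.
move=> GD GN expG diagG GA GB.
have [N N0 [k0 Hk0]] := generic_comm_mul (expm_subgroup_comm expG GA GB)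
  (expm_diagonalizable (diagG A GA)) (expm_diagonalizable (diagG B GB))
  (expm_unit A) (expm_unit B).
have Gn C m : G C -> G (C *+ m) by move=> GC; rewrite pmulrn; apply: subgroup_mulrz.
(* [N (A + k B)] commutes with its exponential [expm A ^+ N * expm B ^+ (N * k)], hence for large
   [k] with [expm A ^+ N] and [expm B ^+ N]. *)
have HC k : (k0 <= k)%N ->
    GRing.comm (expm A ^+ N) (A + B *+ k) /\ GRing.comm (expm B ^+ N) (A + B *+ k).
  move=> /Hk0 /(_ (A *+ N + B *+ (N * k))) H.
  have E : expm (A *+ N + B *+ (N * k)) = expm A ^+ N * expm B ^+ (N * k).
    by rewrite expG ?expmMn //; apply: Gn.
  have [|h1 h2] := H; first by rewrite -E; apply: expm_comm.
  have EN : A *+ N + B *+ (N * k) = (A + B *+ k) *+ N by rewrite mulrnDl -mulrnA mulnC.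
  by rewrite EN in h1 h2; split; apply: (comm_mulrn_inv N0); apply: commr_sym.
have [cUA cUB] := comm_pencil_split (fun k h => (HC k h).1).
have [cVA cVB] := comm_pencil_split (fun k h => (HC k h).2).
(* [N A] and [N B] satisfy the centrality conditions; characteristic zero then removes [N]. *)
have : (A *+ N) * (B *+ N) = (B *+ N) * (A *+ N).
  apply: (@diagonalizable_central_comm G); rewrite ?expmMn //.
  - exact: Gn.
  - exact: Gn.
  - exact/diagG/Gn.
  - exact/diagG/Gn.
  - exact/commr_sym/commrMn.
  - exact/commr_sym/commrMn.
by move/(comm_mulrn_inv N0)/commr_sym/(comm_mulrn_inv N0)/commr_sym.
Qed.

Lemma expm_subgroup_mx_comm (G : 'M[K]_n.+1 -> Prop) A B :
  (forall A B, G A -> G B -> G (A + B)) -> (forall A, G A -> G (- A)) ->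
  (forall A B, G A -> G B -> expm (A + B) = expm A * expm B) ->
  G A -> G B -> A * B = B * A.
Proof.
move=> GD GN expG GA GB.
(* The diagonalizable parts are closed under sums and opposites, and the exponential is again a
   homomorphism on them. *)
pose H D := exists2 M, G M & dunford M D.
have HD D E : H D -> H E -> H (D + E).
  move=> [M GM dM] [M' GM' dM']; exists (M + M'); first exact: GD.
  by have [] := dunford_subgroupD expG GM GM' dM dM'.
have HN D : H D -> H (- D).
  move=> [M GM [dD nD cD]]; exists (- M); first exact: GN.
  split; first exact: diagonalizableN.
    by rewrite opprK addrC -opprB; apply: nilpotent_mxN.
  by apply/commrN/commr_sym/commrN/commr_sym.
have expH D E : H D -> H E -> expm (D + E) = expm D * expm E.
  move=> [M GM dM] [M' GM' dM'].
  by have [] := dunford_subgroupD expG GM GM' dM dM'.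
have diagH D : H D -> diagonalizable D by case=> M _ [].
have [D dA] := dunford_part A; have [E dB] := dunford_part B.
have HDD : H D by exists A.
have HEE : H E by exists B.
have cDE : GRing.comm D E := diagonalizable_subgroup_comm HD HN expH diagH HDD HEE.
have [_ _ cNN] := dunford_subgroupD expG GA GB dA dB.
have pencil k : dunford (A + B *+ k) (D + E *+ k) /\ G (A + B *+ k).
  elim: k => [|k [dk Gk]]; first by rewrite !mulr0n !addr0.
  split; last by rewrite mulrSr addrA; apply: GD.
  by rewrite !mulrSr !addrA; have [] := dunford_subgroupD expG Gk GB dk dB.
have [k0 Hk0] := generic_comm_add cDE (diagH _ HDD) (diagH _ HEE).
(* [D + k E] commutes with whatever commutes with it generically through [D] and [E]: as the
   diagonalizable part of [A + k B] it commutes with [A + k B], so for large [k] both [D] and [E]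
   do. *)
have HC k : (k0 <= k)%N -> GRing.comm D (A + B *+ k) /\ GRing.comm E (A + B *+ k).
  move=> /Hk0 /(_ (A + B *+ k)) h; have [[_ _ /h[h1 h2]] _] := pencil k.
  by split; apply: commr_sym.
have [cDA cDB] := comm_pencil_split (fun k h => (HC k h).1).
have [cEA cEB] := comm_pencil_split (fun k h => (HC k h).2).
(* [A - D] commutes with [B - E] by [dunford_subgroupD], and with [E]. *)
have cA : GRing.comm (A - D) B.
  rewrite -(subrK E B); apply: commrD => //.
  by apply/commr_sym/commrB => //; exact: commr_sym.
by rewrite -(subrK D A) mulrDl mulrDr cA cDB.
Qed.
End AbstractExponential.

(** * The matrix exponential *)

Lemma expp_real_complex (R : rcfType) (a : R) N :
  @expp R[i] R[i]^o (a%:C)%C N = (@expp R R^o a N)%:C%C.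
Proof.
rewrite /expp rmorph_sum; apply: eq_bigr => k _ /=.
by rewrite -[_ *: _]/(_ * _) -[in RHS]/(_ * _) rmorphM rmorphXn fmorphV rmorph_nat.
Qed.

(** Odd powers of [i b] are imaginary, so order [2N] for the exponential corresponds to order [N]
    for the cosine series. *)
Lemma Re_expp_imag (R : rcfType) (b : R) N :
  complex.Re (@expp R[i] R[i]^o (0 +i* b)%C N.*2) =
  \sum_(j < N.+1) (-1) ^+ j / (j.*2)`!%:R * (b ^+ 2) ^+ j.
Proof.
have imX j : ((0 +i* b)%C : R[i]) ^+ j.*2 = (((-1) ^+ j * (b ^+ 2) ^+ j)%:C)%C.
  rewrite -muln2 mulnC exprM -exprMn rmorphXn; congr (_ ^+ _).
  by rewrite expr2; apply/eqP; rewrite eq_complex /=; apply/andP; split; apply/eqP; ring.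
have sc k (z : R[i]) : complex.Re ((k%:R : R[i])^-1 * z) = (k%:R)^-1 * complex.Re z.
  have -> : (k%:R)^-1 = (((k%:R)^-1)%:C)%C :> R[i] by rewrite fmorphV rmorph_nat.
  by case: z => x y /=; rewrite mul0r subr0.
have ReD (z w : R[i]) : complex.Re (z + w) = complex.Re z + complex.Re w.
  by case: z; case: w.
elim: N => [|N IH].
  rewrite /expp !big_ord1 -[_ *: _]/(_ * _) sc -[X in _ ^+ X]double0 imX /=.
  by rewrite !expr0 !mulr1 mul1r.
rewrite doubleS /expp big_ord_recr big_ord_recr /= !ReD -[\sum_(_ < _) _]/(expp _ _).
rewrite IH [RHS]big_ord_recr /= -!/(_ * _) -addrA; congr (_ + _).
rewrite -[_ *: _]/(_ * _) -[X in _ + complex.Re X]/(_ * _) !sc.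
rewrite exprS imX -doubleS imX /= mul0r mulr0 subr0 mulr0 add0r.
by rewrite mulrC mulrAC.
Qed.

(** Meant for [e = e^a] and the exponentials of [i b] and [- i b], of which only the common real
    part [c] is known: [s = 0], then [c^2 = 1], and [e c = 1] with [e > 0] fixes the sign. *)
Lemma complex_unit_aux (F : rcfType) (e c s t : F) : 0 < e ->
  ((e%:C)%C * (c +i* s)%C = 1 :> F[i]) -> ((c +i* s)%C * (c +i* t)%C = 1 :> F[i]) ->
  e = 1 /\ c = 1.
Proof.
move=> e0 [] /= h1 h2 [] h3 _.
have s0 : s = 0.
  by apply/eqP; move/eqP: h2; rewrite mul0r addr0 mulf_eq0 gt_eqF.
have c1 : c = 1 by rewrite s0 in h1 h3; nra.
by split=> //; rewrite c1 in h1; nra.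
Qed.

Local Notation R := Rdefinitions.R.
Local Notation CC := (R[i]).
Local Notation rexp := (@expp R (R^o)).
Local Notation cexpp := (@expp CC (CC^o)).

Lemma Un_cvP (u : nat -> R) (l : R) : Un_cv u l <->
  (forall e : R, 0 < e -> exists N, forall m, (N <= m)%N -> `|u m - l| < e).
Proof.
split=> H e e0.
  have [N HN] := H e (elimT RltP e0); exists N => m Nm.
  by have /RltP := HN m (elimT ssrnat.leP Nm); rewrite RdistE.
have [N HN] := H e (introT RltP e0); exists N => m Nm.
by apply/RltP; rewrite RdistE; apply: HN; apply/ssrnat.leP.
Qed.

Lemma Un_cv_squeeze0 (u v : nat -> R) :
  (forall N, 0 <= u N <= v N) -> Un_cv v 0 -> Un_cv u 0.
Proof.
move=> uv /Un_cvP Hv; apply/Un_cvP=> e /Hv[N HN]; exists N => m /HN.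
have /andP[u0 le] := uv m; rewrite !subr0 !ger0_norm //; last exact: le_trans le.
exact: le_lt_trans.
Qed.

Lemma Un_cv_const (l : R) : Un_cv (fun=> l) l.
Proof. by apply/Un_cvP=> e e0; exists 0%N => m _; rewrite subrr normr0. Qed.

Lemma Un_cv_sum (I : Type) (s : seq I) (u : I -> nat -> R) (l : I -> R) :
  (forall i, Un_cv (u i) (l i)) ->
  Un_cv (fun N => \sum_(i <- s) u i N) (\sum_(i <- s) l i).
Proof.
move=> H; elim: s => [|i s IH].
  rewrite big_nil; apply: Un_cv_ext (Un_cv_const 0) => N; by rewrite big_nil.
rewrite big_cons; apply: Un_cv_ext (CV_plus _ _ _ _ (H i) IH) => N.
by rewrite big_cons.
Qed.

Lemma Un_cv_subseq (u : nat -> R) (l : R) (f : nat -> nat) :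
  (forall N, (N <= f N)%N) -> Un_cv u l -> Un_cv (u \o f) l.
Proof.
move=> Hf /Un_cvP H; apply/Un_cvP=> e /H[N HN]; exists N => m Nm.
by apply: HN; apply: leq_trans Nm (Hf m).
Qed.

Lemma rexp_cv (a : R) : Un_cv (rexp a) (exp a).
Proof.
have : exp_in a (exp a) by rewrite /exp; case: exist_exp.
move=> H; apply: Un_cv_ext H => N; rewrite sum_f_R0E big_mkord.
by apply: eq_bigr => k _; rewrite INRE factE RpowE.
Qed.

Section MatrixExp.
Variable n : nat.
Implicit Types A B E P Z : 'M[CC]_n.+1.

(** A relation: properties are proved for a limit, and uniqueness carries them over to [expm]. *)
Definition is_exp A E := Un_cv (fun N => mxnorm1 (expp A N - E)) 0.

Lemma is_exp_uniq A E E' : is_exp A E -> is_exp A E' -> E = E'.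
Proof.
move=> H H'; apply/eqP; rewrite -subr_eq0; apply/eqP/mxnorm1_eq0.
apply: UL_sequence (Un_cv_const _) _; have := CV_plus _ _ _ _ H' H.
rewrite Rplus_0_l; apply: Un_cv_squeeze0 => N; rewrite mxnorm1_ge0 /=.
have -> : E - E' = (expp A N - E') - (expp A N - E) by apply/esym; rewrite opprB addrC addrA subrK.
by apply: le_trans (mxnorm1D _ _) _; rewrite mxnorm1N.
Qed.

(** The defect of the truncated product is dominated by its real analogue [dn], which tends to [0]
    by the functional equation of the real exponential. *)
Lemma is_expD A B E F : GRing.comm A B -> is_exp A E -> is_exp B F ->
  is_exp (A + B) (E * F).
Proof.
move=> cAB HA HB.
pose dn N := rexp (mxnorm1 A) N * rexp (mxnorm1 B) N - rexp (mxnorm1 A + mxnorm1 B) N.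
have Hd : Un_cv dn 0.
  have := CV_minus _ _ _ _ (CV_mult _ _ _ _ (rexp_cv (mxnorm1 A)) (rexp_cv (mxnorm1 B)))
    (rexp_cv (mxnorm1 A + mxnorm1 B)).
  by rewrite -exp_plus Rminus_diag.
pose x N := mxnorm1 (expp A N - E); pose y N := mxnorm1 (expp B N - F).
have H : Un_cv (fun N => dn N + (x N * (y N + mxnorm1 F) + mxnorm1 E * y N)) 0.
  have := CV_plus _ _ _ _ Hd (CV_plus _ _ _ _
    (CV_mult _ _ _ _ HA (CV_plus _ _ _ _ HB (Un_cv_const (mxnorm1 F))))
    (CV_mult _ _ _ _ (Un_cv_const (mxnorm1 E)) HB)).
  by rewrite !(Rmult_0_l, Rmult_0_r, Rplus_0_l).
apply: Un_cv_squeeze0 H => N; rewrite mxnorm1_ge0 /=.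
have -> : expp (A + B) N - E * F = - (expp A N * expp B N - expp (A + B) N) +
    ((expp A N - E) * expp B N + E * (expp B N - F)).
  by rewrite mulrBl mulrBr opprB addrA subrKA subrKA.
apply: le_trans (mxnorm1D _ _) _; rewrite mxnorm1N; apply: lerD.
  exact: mxnorm1_exppD.
apply: le_trans (mxnorm1D _ _) _; apply: lerD; last exact: mxnorm1M.
apply: le_trans (mxnorm1M _ _) _; apply: ler_wpM2l; first exact: mxnorm1_ge0.
by rewrite -{1}(subrK F (expp B N)); apply: mxnorm1D.
Qed.

Lemma expp_conj P A N : P \is a GRing.unit -> expp (conj_mx P A) N = conj_mx P (expp A N).
Proof.
move=> uP; rewrite /expp /conj_mx mulr_sumr mulr_suml; apply: eq_bigr => k _.
by rewrite -/(conj_mx P A) conj_mxX // -scalerAr -scalerAl.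
Qed.

Lemma is_exp_conj P A E : P \is a GRing.unit -> is_exp A E ->
  is_exp (conj_mx P A) (conj_mx P E).
Proof.
move=> uP H.
have := CV_mult _ _ _ _ (CV_mult _ _ _ _ (Un_cv_const (mxnorm1 P^-1)) H)
  (Un_cv_const (mxnorm1 P)).
rewrite Rmult_0_r Rmult_0_l; apply: Un_cv_squeeze0 => N; rewrite mxnorm1_ge0 /=.
rewrite expp_conj // conj_mxN conj_mxD.
apply: le_trans (mxnorm1M _ _) _; apply: ler_wpM2r; first exact: mxnorm1_ge0.
exact: mxnorm1M.
Qed.

Lemma expp_comm A Z N : GRing.comm Z A -> GRing.comm Z (expp A N).
Proof.
move=> cZ; apply: commr_sum => k _.
rewrite /GRing.comm -scalerAr -scalerAl; congr (_ *: _); exact: commrX.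
Qed.

Lemma is_exp_comm A E Z : is_exp A E -> GRing.comm Z A -> GRing.comm Z E.
Proof.
move=> H cZ; apply/eqP; rewrite -subr_eq0; apply/eqP/mxnorm1_eq0.
apply: UL_sequence (Un_cv_const _) _.
have := CV_mult _ _ _ _ (Un_cv_const (mxnorm1 Z)) H.
move=> H1; have := CV_plus _ _ _ _ H1 H1; rewrite Rmult_0_r Rplus_0_l.
apply: Un_cv_squeeze0 => N; rewrite mxnorm1_ge0 /=.
have -> : Z * E - E * Z = - (Z * (expp A N - E)) + (expp A N - E) * Z.
  rewrite mulrBl mulrBr (expp_comm N cZ) opprB addrA.
  by rewrite -[_ - _ + _]addrA addNr addr0.
apply: le_trans (mxnorm1D _ _) _; rewrite mxnorm1N; apply: lerD; first exact: mxnorm1M.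
by apply: le_trans (mxnorm1M _ _) _; rewrite mulrC.
Qed.

Lemma is_exp_nilpotent A m : A ^+ m.+1 = 0 -> is_exp A (expp A m).
Proof.
move=> A0; apply/Un_cvP=> e e0; exists m => N mN.
suff -> : expp A N = expp A m by rewrite subrr mxnorm1_0 subrr normr0.
elim: N mN => [|N IH]; first by rewrite leqn0 => /eqP->.
rewrite leq_eqVlt => /orP[/eqP->//|]; rewrite ltnS => mN.
rewrite -IH // /expp [LHS]big_ord_recr /=.
have -> : A ^+ N.+1 = 0 by rewrite -(subnK mN) -addnS exprD A0 mulr0.
by rewrite scaler0 addr0.
Qed.

Lemma is_exp_entries A E :
  (forall i j, Un_cv (fun N => cnorm1 (expp A N i j - E i j)) 0) -> is_exp A E.
Proof.
move=> H.
have := Un_cv_sum (index_enum _) (fun i => Un_cv_sum (index_enum _) (fun j => H i j)).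
rewrite big1 => [|i _]; last by rewrite big1.
apply: Un_cv_ext => N; apply: eq_bigr => i _; apply: eq_bigr => j _.
by rewrite !mxE.
Qed.

Lemma Un_cv_cnorm1 (u : nat -> CC) (l : CC) :
  Un_cv (fun N => complex.Re (u N)) (complex.Re l) ->
  Un_cv (fun N => complex.Im (u N)) (complex.Im l) ->
  Un_cv (fun N => cnorm1 (u N - l)) 0.
Proof.
move=> /Un_cvP Hr /Un_cvP Hi; apply/Un_cvP=> e e0.
have e2 : 0 < e / 2 by rewrite divr_gt0.
have [N HN] := Hr _ e2; have [M HM] := Hi _ e2; exists (maxn N M) => m.
rewrite geq_max => /andP[/HN h1 /HM h2]; rewrite subr0 ger0_norm ?cnorm1_ge0 //.
rewrite /cnorm1 [e]splitr; case: (u m) h1 h2 => a b; case: (l) => c d.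
exact: ltrD.
Qed.

Lemma cnorm1_Un_cv (u : nat -> CC) (l : CC) :
  Un_cv (fun N => cnorm1 (u N - l)) 0 ->
  Un_cv (fun N => complex.Re (u N)) (complex.Re l) /\
  Un_cv (fun N => complex.Im (u N)) (complex.Im l).
Proof.
move=> /Un_cvP H; split; apply/Un_cvP=> e /H[N HN]; exists N => m /HN;
  rewrite subr0 ger0_norm ?cnorm1_ge0 //; apply: le_lt_trans;
  case: (u m) => a b; case: (l) => c d; rewrite /cnorm1.
  by rewrite lerDl.
by rewrite lerDr.
Qed.

(** Differences of partial sums are dominated by those of the real exponential series at
    [mxnorm1 A]; [f] will be the real or the imaginary part. *)
Lemma expp_entry_cauchy A i j (f : CC -> R) : (forall z w, f (z - w) = f z - f w) ->
  (forall z, `|f z| <= cnorm1 z) ->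
  exists l, Un_cv (fun N => f (expp A N i j)) l.
Proof.
move=> fB fn; suff : Cauchy_crit (fun N => f (expp A N i j)).
  by case/R_complete => l Hl; exists l.
have H := CV_Cauchy _ (exist _ _ (rexp_cv (mxnorm1 A))).
move=> e e0; have [N HN] := H e e0; exists N => p q Np Nq.
wlog pq : p q Np Nq / (p <= q)%N.
  move=> hw; have [pq|/ltnW pq] := leqP p q; first exact: hw.
  by rewrite Rdist_sym; apply: hw.
apply: Rle_lt_trans (HN q p Nq Np); apply/RleP; rewrite !RdistE distrC -fB.
apply: le_trans (fn _) _; apply: le_trans (_ : mxnorm1 (expp A q - expp A p) <= _).
  by have := cnorm1_le_mx (expp A q - expp A p) i j; rewrite !mxE.
by apply: le_trans (mxnorm1_exppB _ pq) _; apply: ler_norm.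
Qed.

Lemma expp_Re_cv A i j : exists l, Un_cv (fun N => complex.Re (expp A N i j)) l.
Proof.
apply: (@expp_entry_cauchy A i j (@complex.Re R)) => [[? ?] [? ?] //|[a b]].
by rewrite /cnorm1 lerDl.
Qed.

Lemma expp_Im_cv A i j : exists l, Un_cv (fun N => complex.Im (expp A N i j)) l.
Proof.
apply: (@expp_entry_cauchy A i j (@complex.Im R)) => [[? ?] [? ?] //|[a b]].
by rewrite /cnorm1 lerDr.
Qed.

Lemma is_exp_exists A : exists E, is_exp A E.
Proof.
pose lre i j := epsilon (inhabits 0) (Un_cv (fun N => complex.Re (expp A N i j))).
pose lim i j := epsilon (inhabits 0) (Un_cv (fun N => complex.Im (expp A N i j))).
exists (\matrix_(i, j) (lre i j +i* lim i j)%C); apply: is_exp_entries => i j.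
rewrite mxE; apply: Un_cv_cnorm1; apply: epsilon_spec.
  exact: expp_Re_cv.
exact: expp_Im_cv.
Qed.

(* [Qed] keeps the limit from being unfolded in conversion checks. *)
Fact expm_sig A : {E | is_exp A E}.
Proof. exact: constructive_indefinite_description (is_exp_exists A). Qed.

Definition expm A := sval (expm_sig A).

Lemma expmP A : is_exp A (expm A).
Proof. exact: svalP. Qed.

Lemma expmE A E : is_exp A E -> expm A = E.
Proof. by move=> H; apply: is_exp_uniq (expmP A) H. Qed.

Lemma expmD A B : GRing.comm A B -> expm (A + B) = expm A * expm B.
Proof. by move=> cAB; apply/expmE/is_expD => //; apply: expmP. Qed.

Lemma expm_conj P A : P \is a GRing.unit -> expm (conj_mx P A) = conj_mx P (expm A).
Proof. by move=> uP; apply/expmE/is_exp_conj => //; apply: expmP. Qed.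

Lemma expm_comm A Z : GRing.comm Z A -> GRing.comm Z (expm A).
Proof. exact/is_exp_comm/expmP. Qed.

Lemma expm_nilpotent A m : A ^+ m.+1 = 0 -> expm A = expp A m.
Proof. by move=> A0; apply/expmE/is_exp_nilpotent. Qed.

End MatrixExp.

(** Taken as a [1 x 1] matrix exponential, so that its addition formula is a case of [expmD]. *)
Definition cexp (z : CC) : CC := expm (z%:M : 'M[CC]_1) 0 0.

Lemma cexp_cv z : Un_cv (fun N => cnorm1 (cexpp z N - cexp z)) 0.
Proof.
apply: Un_cv_squeeze0 (expmP (z%:M : 'M[CC]_1)) => N; rewrite cnorm1_ge0 /=.
have -> : expp (z%:M : 'M[CC]_1) N = (cexpp z N)%:M.
  rewrite /expp raddf_sum; apply: eq_bigr => k _ /=.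
  by rewrite -rmorphXn /= scale_scalar_mx.
have := cnorm1_le_mx ((cexpp z N)%:M - expm (z%:M : 'M[CC]_1)) 0 0.
by rewrite [X in cnorm1 X]mxE [X in cnorm1 (X + _)]mxE mulr1n [X in cnorm1 (_ + X)]mxE.
Qed.

Lemma cexpD z w : cexp (z + w) = cexp z * cexp w.
Proof.
rewrite /cexp raddfD /= expmD; last exact: comm_mx_scalar.
by rewrite mxE big_ord1.
Qed.

Lemma cexp0 : cexp 0 = 1.
Proof.
rewrite /cexp raddf0 (@expm_nilpotent _ _ 0) ?expr1 // /expp big_ord1 expr0 fact0 invr1.
by rewrite scale1r mxE.
Qed.

Lemma cexp_real (a : R) : cexp (a%:C)%C = ((exp a)%:C)%C.
Proof.
have [Hr Hi] := cnorm1_Un_cv (cexp_cv (a%:C)%C).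
apply/eqP; rewrite eq_complex; apply/andP; split; apply/eqP.
  apply: UL_sequence Hr _; apply: Un_cv_ext (rexp_cv a) => N.
  by rewrite expp_real_complex.
apply: UL_sequence Hi _; apply: Un_cv_ext (Un_cv_const 0) => N.
by rewrite expp_real_complex.
Qed.

Lemma cexp_imag_Re (b : R) : complex.Re (cexp (0 +i* b)%C) = cos b.
Proof.
have [Hr _] := cnorm1_Un_cv (cexp_cv (0 +i* b)%C).
have {}Hr := @Un_cv_subseq _ _ double (fun N => ltac:(by rewrite -addnn leq_addr)) Hr.
apply: UL_sequence Hr _.
have : cos_in (Rsqr b) (cos b) by rewrite /cos; case: exist_cos.
move=> H; apply: Un_cv_ext H => N; rewrite sum_f_R0E big_mkord /= Re_expp_imag.
apply: eq_bigr => j _; rewrite /cos_n (_ : Nat.mul 2 j = j.*2); last by rewrite multE mul2n.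
by rewrite RpowE INRE factE RdivE RmultE RpowE.
Qed.

Definition two_pi_i : CC := (0 +i* (PI *+ 2))%C.

Lemma two_pi_i_neq0 : two_pi_i != 0.
Proof.
have pi0 : 0 < PI by apply/RltP; apply: PI_RGT_0.
apply/eqP=> /(congr1 (@complex.Im R)); rewrite -[LHS]/(PI *+ 2) -[RHS]/0 => /eqP.
by rewrite mulrn_eq0 (gt_eqF pi0) orbF; move/eqP.
Qed.

Lemma IZR_int (k : Z) : exists m : int, IZR k = m%:~R.
Proof.
case: k => [|p|p].
- by exists 0.
- by exists (nat_of_pos p : int); rewrite IZRposE INRE pmulrn.
- exists (- (nat_of_pos p : int)); rewrite mulrNz -pmulrn -INRE -IZRposE.
  by rewrite -RoppE -opp_IZR.
Qed.

(** From [cos b = 1 - 2 sin^2 (b / 2)] follows [sin (b / 2) = 0]. *)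
Lemma cos_eq1 (b : R) : cos b = 1 -> exists k : int, b = k%:~R * (PI *+ 2).
Proof.
move=> cb; have /sin_eq_0_0 [k Hk] : sin (Rdiv b (IZR 2)) = IZR 0.
  have := cos_2a_sin (Rdiv b (IZR 2)).
  replace (Rmult (IZR 2) (Rdiv b (IZR 2))) with b by Lra.lra.
  rewrite cb -R1E => e; apply: Rsqr_0_uniq; rewrite /Rsqr; Lra.lra.
have [m Hm] := IZR_int k; exists m.
have -> : b = Rmult (IZR k) (Rplus PI PI) by Lra.lra.
by rewrite Hm.
Qed.

Lemma cexp_eq1 z : cexp z = 1 -> exists k : int, z = k%:~R * two_pi_i.
Proof.
case: z => a b z1.
have E (c : R) : (a +i* c)%C = (a%:C)%C + (0 +i* c)%C :> CC.
  by apply/eqP; rewrite eq_complex; apply/andP; split; apply/eqP;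
    [exact/esym/addr0 | exact/esym/add0r].
move: z1; rewrite E cexpD cexp_real; move: (cexp_imag_Re b).
have : cexp (0 +i* b)%C * cexp (0 +i* (- b))%C = 1.
  rewrite -cexpD -[RHS]cexp0; congr cexp; apply/eqP; rewrite eq_complex.
  by apply/andP; split; apply/eqP; [exact: addr0 | exact: subrr].
move: (cexp_imag_Re (- b)); rewrite cos_neg.
case: (cexp _) => c s /= -> ; case: (cexp _) => c' t /= h2 h3 h1.
rewrite h3 in h2 h1.
have ea : 0 < exp a by apply/RltP; apply: exp_pos.
have [ea1 /cos_eq1[k ->]] := complex_unit_aux ea h1 h2.
have -> : a = 0 by apply: exp_inv; rewrite exp_0.
exists k; rewrite /two_pi_i.
have -> : (0%:C)%C + (0 +i* (k%:~R * (PI *+ 2)))%C = (0 +i* (k%:~R * (PI *+ 2)))%C :> CC.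
  by rewrite rmorph0 add0r.
have -> : k%:~R = ((k%:~R)%:C)%C :> CC by rewrite rmorph_int.
apply/eqP; rewrite eq_complex; apply/andP; split; apply/eqP.
  by rewrite -[LHS]/0 -[RHS]/(k%:~R * 0 - 0 * _) mulr0 mul0r subr0.
by rewrite -[RHS]/(k%:~R * _ + 0 * 0) mul0r addr0.
Qed.

Section Diag.
Variable n : nat.

Lemma expm_diag (d : 'rV[CC]_n.+1) : expm (diag_mx d) = diag_mx (\row_i cexp (d 0 i)).
Proof.
apply/expmE/is_exp_entries => i j.
have E N : expp (diag_mx d) N = diag_mx (\row_i cexpp (d 0 i) N).
  rewrite /expp; transitivity (\sum_(k < N.+1) diag_mx (\row_i ((k`!%:R)^-1 * d 0 i ^+ k))).
    apply: eq_bigr => k _; rewrite diag_mxX -linearZ; congr diag_mx.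
    by apply/rowP=> l; rewrite !mxE.
  rewrite -raddf_sum; congr diag_mx; apply/rowP=> l; rewrite summxE mxE.
  by apply: eq_bigr => k _; rewrite mxE.
have [->|ne] := eqVneq i j.
  by apply: Un_cv_ext (cexp_cv (d 0 j)) => N; rewrite E !mxE eqxx !mulr1n.
apply: Un_cv_ext (Un_cv_const 0) => N; rewrite E !mxE (negPf ne) !mulr0n subrr.
by rewrite /cnorm1 /= !normr0 -[RHS]/(0 + 0) addr0.
Qed.
End Diag.

(** * Transfer to the matrices of the statement *)

Lemma complex_archimedean (x : CC) : exists m : nat, `|x| <= m%:R.
Proof.
pose r : R := complex.Re `|x|.
have xr : `|x| = (r%:C)%C by rewrite /r RRe_real ?normr_real.
have r0 : 0 <= r by have := normr_ge0 x; rewrite xr -(rmorph0 (real_complex R)) lecR.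
exists (Num.bound r); rewrite xr -(rmorph_nat (real_complex R)) lecR.
exact/ltW/archi_boundP.
Qed.

Definition to_complex (z : Defs.C) : CC := (z.1 +i* z.2)%C.

Lemma to_complex_inj : injective to_complex.
Proof. by move=> [a b] [c d] [-> ->]. Qed.

Lemma to_complex_sum m f : to_complex (Csum m f) = \sum_(l < m) to_complex (f l).
Proof.
elim: m => [|m IH]; first by rewrite big_ord0.
by rewrite big_ord_recr -IH.
Qed.

Section Bridge.
Variable n : nat.
Implicit Types A B : Mat.

Definition to_mx A : 'M[CC]_n.+1 := \matrix_(i, j) to_complex (A i j).

Lemma to_mxP A B : Meq n.+1 A B <-> to_mx A = to_mx B.
Proof.
split=> [H|H i j /ssrnat.ltP lti /ssrnat.ltP ltj].
  by apply/matrixP=> i j; rewrite !mxE H //; apply/ssrnat.ltP; apply: ltn_ord.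
move/matrixP/(_ (Ordinal lti) (Ordinal ltj)): H; rewrite !mxE.
exact: to_complex_inj.
Qed.

Lemma to_mxD A B : to_mx (Madd A B) = to_mx A + to_mx B.
Proof. by apply/matrixP=> i j; rewrite !mxE. Qed.

Lemma to_mxN A : to_mx (Mopp A) = - to_mx A.
Proof. by apply/matrixP=> i j; rewrite !mxE. Qed.

Lemma to_mxM A B : to_mx (Mmul n.+1 A B) = to_mx A * to_mx B.
Proof.
apply/matrixP=> i j; rewrite !mxE to_complex_sum; apply: eq_bigr => l _.
by rewrite !mxE.
Qed.

Lemma to_mx1 : to_mx Mid = 1.
Proof.
apply/matrixP=> i j; rewrite !mxE /Mid; have [->|ne] := eqVneq i j.
  by rewrite PeanoNat.Nat.eqb_refl.
by case: PeanoNat.Nat.eqb_spec => // /val_inj e; rewrite e eqxx in ne.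
Qed.

Lemma to_mxX A k : to_mx (Mpow n.+1 A k) = to_mx A ^+ k.
Proof.
elim: k => [|k IH]; first exact: to_mx1.
by rewrite exprSr -IH -to_mxM.
Qed.

Lemma to_mxZ k A : to_mx (Mrscale (Rinv (INR k)) A) = (k%:R)^-1 *: to_mx A.
Proof.
have -> : (k%:R)^-1 = (((k%:R)^-1)%:C)%C :> CC by rewrite fmorphV rmorph_nat.
apply/matrixP=> i j; rewrite !mxE /Mrscale /Crscale INRE RinvE.
case: (A i j) => a b; apply/eqP; rewrite eq_complex.
apply/andP; split; apply/eqP; apply: esym.
  by rewrite -[LHS]/(k%:R^-1 * a - 0 * b) mul0r subr0.
by rewrite -[LHS]/(k%:R^-1 * b + 0 * a) mul0r addr0.
Qed.

Lemma to_mx_exp_partial A N : to_mx (exp_partial n.+1 A N) = expp (to_mx A) N.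
Proof.
elim: N => [|N IH].
  by rewrite to_mx1 /expp big_ord1 expr0 fact0 invr1 scale1r.
rewrite [exp_partial _ _ _]/(Madd _ _) to_mxD IH to_mxZ to_mxX factE.
by rewrite [RHS]/expp big_ord_recr.
Qed.

Lemma to_mx_Mexp A : to_mx (Mexp n.+1 A) = expm (to_mx A).
Proof.
apply/esym/expmE/is_exp_entries => i j.
have E N : expp (to_mx A) N i j = to_complex (exp_partial n.+1 A N i j).
  by rewrite -to_mx_exp_partial mxE.
rewrite mxE; apply: Un_cv_cnorm1.
  have [l Hl] := expp_Re_cv (to_mx A) i j.
  (* The limit in [Mexp] is picked by [epsilon], which satisfies its predicate once some limit
     exists. *)
  have H : exists l, Un_cv (fun N => (exp_partial n.+1 A N i j).1) l.
    by exists l; apply: Un_cv_ext Hl => N; rewrite E.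
  by apply: Un_cv_ext (epsilon_spec (inhabits 0%R) _ H) => N; rewrite E.
have [l Hl] := expp_Im_cv (to_mx A) i j.
have H : exists l, Un_cv (fun N => (exp_partial n.+1 A N i j).2) l.
  by exists l; apply: Un_cv_ext Hl => N; rewrite E.
by apply: Un_cv_ext (epsilon_spec (inhabits 0%R) _ H) => N; rewrite E.
Qed.

End Bridge.

Theorem theorem2 (n : nat) (G : Mat -> Prop) :
  is_add_subgroup n G ->
  (forall A B, G A -> G B -> Meq n (Mexp n (Madd A B)) (Mmul n (Mexp n A) (Mexp n B))) ->
  forall A B, G A -> G B -> Meq n (Mmul n A B) (Mmul n B A).
Proof.
case: n => [|n] [_ [GD GN]] expG A B GA GB.
  (* In size [0] there is no entry to compare; the matrix ring used afterwards has positive size. *)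
  by move=> i j /ssrnat.ltP.
apply/to_mxP; rewrite !to_mxM.
pose G' (M : 'M[CC]_n.+1) := exists2 A, G A & to_mx n A = M.
apply: (@expm_subgroup_mx_comm _ n cexp two_pi_i (@expm n) complex_archimedean
  two_pi_i_neq0 cexp_eq1 (@expmD n) (@expm_conj n) (@expm_comm n) (@expm_nilpotent n)
  (@expm_diag n) G').
- move=> _ _ [A1 GA1 <-] [B1 GB1 <-]; exists (Madd A1 B1); first exact: GD.
  exact: to_mxD.
- move=> _ [A1 GA1 <-]; exists (Mopp A1); first exact: GN.
  exact: to_mxN.
- move=> _ _ [A1 GA1 <-] [B1 GB1 <-].
  rewrite -to_mxD -!to_mx_Mexp -to_mxM; apply/to_mxP; exact: expG.
- by exists A.
- by exists B.
Qed.
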